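(* The 2-category $\mathbf{Acc}_0$ is closed under PIE-limits (products, inserters, equifiers) in $\mathbf{Acc}$. Explicitly: (Products) If $(\mathcal K_i)_{i\in I}$ is a family, indexed by a set $I$, of accessible categories with directed colimits, then the product category $\prod_{i\in I}\mathcal K_i$ is accessible and has directed colimits, the projections $P_i:\prod_{i\in I}\mathcal K_i\to\mathcal K_i$ preserve directed colimits, and for every accessible category $\mathcal L$ with directed colimits and every family of functors $Q_i:\mathcal L\to\mathcal K_i$ preserving directed colimits, the induced functor $\mathcal L\to\prod_{i\in I}\mathcal K_i$ preserves directed colimits. (Inserters) If $F,G:\mathcal K\to\mathcal L$ are directed-colimit-preserving functors between accessible categories with directed colimits, then $\operatorname{Ins}(F,G)$ is accessible and has directed colimits, the projection $P:\operatorname{Ins}(F,G)\to\mathcal K$ preserves directed colimits, and for every accessible category $\mathcal H$ with directed colimits, every directed-colimit-preserving functor $H:\mathcal H\to\mathcal K$ and every natural transformation $\psi:FH\to GH$, the induced functor $\bar H:\mathcal H\to\operatorname{Ins}(F,G)$ preserves directed colimits. (Equifiers) If moreover $\varphi,\psi:F\to G$ are natural transformations between such functors $F,G:\mathcal K\to\mathcal L$, then $\operatorname{Eq}(\varphi,\psi)$ is accessible and has directed colimits, the inclusion $P:\operatorname{Eq}(\varphi,\psi)\to\mathcal K$ preserves directed colimits, and for every accessible category $\mathcal H$ with directed colimits and every directed-colimit-preserving functor $H:\mathcal H\to\mathcal K$ with $\varphi H=\psi H$, the induced functor $\bar H:\mathcal H\to\operatorname{Eq}(\varphi,\psi)$ preserves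 directed colimits.
   Context: A category is $\lambda$-accessible ($\lambda$ a regular cardinal) if it has $\lambda$-directed colimits and, up to isomorphism, a set $\mathcal A$ of $\lambda$-presentable objects such that every object is a $\lambda$-directed colimit of objects of $\mathcal A$; it is accessible if it is $\lambda$-accessible for some regular $\lambda$. A functor $F:\mathcal K\to\mathcal L$ is accessible if for some $\lambda$ both categories are $\lambda$-accessible and $F$ preserves $\lambda$-directed colimits. $\mathbf{Acc}$ is the 2-category of accessible categories, accessible functors and natural transformations; PIE-limits in it are calculated as in the 2-category of all categories. $\mathbf{Acc}_0$ is the 2-category whose objects are accessible categories having all directed colimits, whose morphisms are functors preserving directed colimits, and whose 2-cells are natural transformations. Given functors $F,G:\mathcal K\to\mathcal L$, the inserter $\operatorname{Ins}(F,G)$ is the category whose objects are pairs $(K,f)$ with $f:FK\to GK$ in $\mathcal L$, a morphism $(K,f)\to(K',f')$ being a morphism $k:K\to K'$ in $\mathcal K$ with $f'\circ Fk=Gk\circ f$; $P:\operatorname{Ins}(F,G)\to\mathcal K$ is the projection $(K,f)\mapsto K$, and there is a natural transformation $FP\to GP$ with component $f$ at $(K,f)$. For $H:\mathcal H\to\mathcal K$ and $\psi:FH\to GH$ the induced functor $\bar H:\mathcal H\to\operatorname{Ins}(F,G)$ sends $X$ to $(HX,\psi_X)$ and acts as $H$ on morphisms. Given natural transformations $\varphi,\psi:F\to G$, the equifier $\operatorname{Eq}(\varphi,\psi)$ is the full subcategory of $\mathcal K$ on the objects $K$ with $\varphi_K=\psi_K$; a functor $H:\mathcal H\to\mathcal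 K$ with $\varphi H=\psi H$ factors uniquely through it as $\bar H$. *)

(* Defs.v *)
From mathcomp Require Import all_boot.
From mathcomp Require Import boolp classical_sets functions cardinality.

Set Implicit Arguments.
Unset Strict Implicit.
Unset Printing Implicit Defensive.

Local Open Scope classical_set_scope.
Local Open Scope card_scope.

(* A single fixed universe: a "set" is a type in [small], while objects of a
   category may live in a strictly larger universe. *)
Definition small := Type.

Declare Scope cat_scope.
Delimit Scope cat_scope with cat.
Reserved Notation "g \oc f" (at level 40, left associativity).

(* Categories are locally small; equality of morphisms is Leibniz equality. *)
Record Cat := MkCat {
  Obj :> Type;
  Hom : Obj -> Obj -> small;
  idc : forall x, Hom x x;
  ccomp : forall x y z, Hom y z -> Hom x y -> Hom x z;
  ccomp_id_l : forall x y (f : Hom x y), ccomp (idc y) f = f;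
  ccomp_id_r : forall x y (f : Hom x y), ccomp f (idc x) = f;
  ccompA : forall x y z t (h : Hom z t) (g : Hom y z) (f : Hom x y),
    ccomp h (ccomp g f) = ccomp (ccomp h g) f }.

Arguments idc {c} x.
Notation "g \oc f" := (ccomp g f) : cat_scope.
Local Open Scope cat_scope.

Record Functor (C D : Cat) := MkFunctor {
  fobj :> C -> D;
  fmap : forall x y, Hom x y -> Hom (fobj x) (fobj y);
  fmap_id : forall x, fmap (idc x) = idc (fobj x);
  fmap_comp : forall x y z (g : Hom y z) (f : Hom x y),
    fmap (g \oc f) = fmap g \oc fmap f }.

Arguments fmap {C D} F {x y} f : rename.

Record NatTrans (C D : Cat) (F G : Functor C D) := MkNatTrans {
  ncomp :> forall x, Hom (F x) (G x);
  naturality : forall x y (f : Hom x y),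
    ncomp y \oc fmap F f = fmap G f \oc ncomp x }.

Definition fcompose (C D E : Cat) (G : Functor D E) (F : Functor C D) :
  Functor C E.
Proof.
refine (@MkFunctor C E (fun x => G (F x)) (fun x y f => fmap G (fmap F f)) _ _).
- by move=> x; rewrite !fmap_id.
- by move=> x y z g f; rewrite !fmap_comp.
Defined.

Definition whisker (B C D : Cat) (F G : Functor C D) (phi : NatTrans F G)
  (H : Functor B C) : NatTrans (fcompose F H) (fcompose G H).
Proof.
refine (@MkNatTrans B D (fcompose F H) (fcompose G H) (fun x => phi (H x)) _).
by move=> x y f; exact: (naturality phi (fmap H f)).
Defined.

Definition isomorphic (C : Cat) (x y : C) : Prop :=
  exists (f : Hom x y) (g : Hom y x), g \oc f = idc x /\ f \oc g = idc y.

Record Cocone (J C : Cat) (X : Functor J C) := MkCocone {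
  apex : C;
  leg : forall j, Hom (X j) apex;
  leg_compat : forall i j (u : Hom i j), leg j \oc fmap X u = leg i }.

Definition is_colimit (J C : Cat) (X : Functor J C) (c : Cocone X) : Prop :=
  forall c' : Cocone X,
    exists! h : Hom (apex c) (apex c'), forall j, h \oc leg c j = leg c' j.

Definition map_cocone (J C D : Cat) (F : Functor C D) (X : Functor J C)
  (c : Cocone X) : Cocone (fcompose F X).
Proof.
refine (@MkCocone J D (fcompose F X) (F (apex c)) (fun j => fmap F (leg c j)) _).
by move=> i j u; rewrite -(leg_compat c u) fmap_comp.
Defined.

Record Poset := MkPoset {
  carrier : small;
  ple : carrier -> carrier -> Prop;
  ple_refl : forall x, ple x x;
  ple_trans : forall y x z, ple x y -> ple y z -> ple x z;
  ple_anti : forall x y, ple x y -> ple y x -> x = y }.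

Definition poset_cat (P : Poset) : Cat.
Proof.
refine (@MkCat (carrier P) (fun x y => ple x y) (@ple_refl P)
  (fun x y z g f => ple_trans f g) _ _ _);
  by move=> *; apply: Prop_irrelevance.
Defined.

Definition directed (P : Poset) : Prop :=
  inhabited (carrier P) /\
  forall x y : carrier P, exists z, ple x z /\ ple y z.

Definition card_lt (T U : Type) (A : set T) (B : set U) : Prop :=
  A #<= B /\ ~ (B #<= A).

(* Cardinals are represented by small types, compared through injections: an
   infinite cardinal is regular when it is not a sum of fewer than lambda
   cardinals smaller than lambda. *)
Definition regular_cardinal (lambda : small) : Prop :=
  infinite_set [set: lambda] /\
  forall (I : small) (X : I -> small),
    card_lt [set: I] [set: lambda] ->
    (forall i, card_lt [set: X i] [set: lambda]) ->
    card_lt [set: {i : I & X i}] [set: lambda].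

Definition lambda_directed (lambda : small) (P : Poset) : Prop :=
  forall S : set (carrier P), card_lt S [set: lambda] ->
    exists u, forall x, S x -> ple x u.

Definition has_directed_colimits (C : Cat) : Prop :=
  forall P : Poset, directed P ->
  forall X : Functor (poset_cat P) C, exists c : Cocone X, is_colimit c.

Definition preserves_directed_colimits (C D : Cat) (F : Functor C D) : Prop :=
  forall P : Poset, directed P ->
  forall (X : Functor (poset_cat P) C) (c : Cocone X),
    is_colimit c -> is_colimit (map_cocone F c).

Definition has_lambda_directed_colimits (lambda : small) (C : Cat) : Prop :=
  forall P : Poset, lambda_directed lambda P ->
  forall X : Functor (poset_cat P) C, exists c : Cocone X, is_colimit c.

Definition preserves_lambda_directed_colimits (lambda : small) (C D : Cat)
    (F : Functor C D) : Prop :=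
  forall P : Poset, lambda_directed lambda P ->
  forall (X : Functor (poset_cat P) C) (c : Cocone X),
    is_colimit c -> is_colimit (map_cocone F c).

Definition set_cat : Cat :=
  @MkCat small (fun A B => A -> B) (fun A x => x)
    (fun A B C g f x => g (f x))
    (fun A B f => erefl) (fun A B f => erefl)
    (fun A B C D h g f => erefl).

Definition hom_functor (C : Cat) (K : C) : Functor C set_cat.
Proof.
refine (@MkFunctor C set_cat (fun x => Hom K x) (fun x y f u => f \oc u) _ _).
- by move=> x; apply/funext => u; apply: ccomp_id_l.
- by move=> x y z g f; apply/funext => u; rewrite /= ccompA.
Defined.

Definition presentable (lambda : small) (C : Cat) (K : C) : Prop :=
  preserves_lambda_directed_colimits lambda (hom_functor K).

(* [A] is a small family of lambda-presentables, taken up to isomorphism. *)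
Definition lambda_accessible (lambda : small) (C : Cat) : Prop :=
  has_lambda_directed_colimits lambda C /\
  exists (J : small) (A : J -> C),
    (forall j, presentable lambda (A j)) /\
    forall x : C, exists (P : Poset) (X : Functor (poset_cat P) C)
                         (c : Cocone X),
      [/\ lambda_directed lambda P,
          forall p : carrier P, exists j, isomorphic (X p) (A j),
          is_colimit c
        & apex c = x].

Definition accessible (C : Cat) : Prop :=
  exists lambda : small, regular_cardinal lambda /\ lambda_accessible lambda C.

Definition prod_cat (I : small) (K : I -> Cat) : Cat.
Proof.
refine (@MkCat (forall i, K i) (fun x y => forall i, Hom (x i) (y i))
  (fun x i => idc (x i)) (fun x y z g f i => g i \oc f i) _ _ _).
- by move=> x y f; apply: functional_extensionality_dep => i; apply: ccomp_id_l.
- by move=> x y f; apply: functional_extensionality_dep => i; apply: ccomp_id_r.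
- by move=> x y z t h g f; apply: functional_extensionality_dep => i; apply: ccompA.
Defined.

Definition prod_proj (I : small) (K : I -> Cat) (i : I) :
  Functor (prod_cat K) (K i) :=
  @MkFunctor (prod_cat K) (K i) (fun x => x i) (fun x y f => f i)
    (fun x => erefl) (fun x y z g f => erefl).

Definition prod_lift (I : small) (K : I -> Cat) (L : Cat)
  (Q : forall i, Functor L (K i)) : Functor L (prod_cat K).
Proof.
refine (@MkFunctor L (prod_cat K) (fun x i => Q i x)
  (fun x y f i => fmap (Q i) f) _ _).
- by move=> x; apply: functional_extensionality_dep => i; apply: fmap_id.
- by move=> x y z g f; apply: functional_extensionality_dep => i;
    apply: fmap_comp.
Defined.

Section Inserter.
Variables (K L : Cat) (F G : Functor K L).

Definition ins_obj := {x : K & Hom (F x) (G x)}.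

Definition ins_hom (a b : ins_obj) : small :=
  {k : Hom (projT1 a) (projT1 b) |
    projT2 b \oc fmap F k = fmap G k \oc projT2 a}.

Lemma ins_hom_eq (a b : ins_obj) (f g : ins_hom a b) :
  sval f = sval g -> f = g.
Proof.
by case: f g => [f Pf] [g Pg] /= fg; subst g; rewrite (Prop_irrelevance Pf Pg).
Qed.

Definition ins_id (a : ins_obj) : ins_hom a a.
Proof. by exists (idc (projT1 a)); rewrite !fmap_id ccomp_id_l ccomp_id_r. Defined.

Definition ins_comp (a b c : ins_obj) (g : ins_hom b c) (f : ins_hom a b) :
  ins_hom a c.
Proof.
exists (sval g \oc sval f).
by rewrite !fmap_comp ccompA (svalP g) -ccompA (svalP f) ccompA.
Defined.

Definition inserter : Cat.
Proof.
refine (@MkCat ins_obj ins_hom ins_id ins_comp _ _ _);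
  move=> *; apply: ins_hom_eq.
- exact: ccomp_id_l.
- exact: ccomp_id_r.
- exact: ccompA.
Defined.

Definition ins_proj : Functor inserter K :=
  @MkFunctor inserter K (fun a : ins_obj => projT1 a)
    (fun a b (f : ins_hom a b) => sval f)
    (fun a => erefl) (fun a b c g f => erefl).

Definition ins_lift (B : Cat) (H : Functor B K)
  (psi : NatTrans (fcompose F H) (fcompose G H)) : Functor B inserter.
Proof.
refine (@MkFunctor B inserter
  (fun x => existT (fun k : K => Hom (F k) (G k)) (H x) (psi x))
  (fun x y f => exist _ (fmap H f) (naturality psi f)) _ _).
- by move=> x; apply: ins_hom_eq; apply: fmap_id.
- by move=> x y z g f; apply: ins_hom_eq; apply: fmap_comp.
Defined.

End Inserter.

Definition full_sub (C : Cat) (P : C -> Prop) : Cat :=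
  @MkCat {x : C | P x} (fun a b => Hom (sval a) (sval b))
    (fun a => idc (sval a)) (fun a b c g f => g \oc f)
    (fun a b f => ccomp_id_l f) (fun a b f => ccomp_id_r f)
    (fun a b c d h g f => ccompA h g f).

Definition full_sub_incl (C : Cat) (P : C -> Prop) : Functor (full_sub P) C :=
  @MkFunctor (full_sub P) C (fun a : {x : C | P x} => sval a) (fun a b f => f)
    (fun a => erefl) (fun a b c g f => erefl).

Section Equifier.
Variables (K L : Cat) (F G : Functor K L) (phi psi : NatTrans F G).

Definition equifier : Cat := full_sub (fun x : K => phi x = psi x).

Definition eq_incl : Functor equifier K :=
  full_sub_incl (fun x : K => phi x = psi x).

Definition eq_lift (B : Cat) (H : Functor B K)
  (e : whisker phi H = whisker psi H) : Functor B equifier :=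
  @MkFunctor B equifier
    (fun x => exist (fun k : K => phi k = psi k) (H x)
       (f_equal (fun t : NatTrans (fcompose F H) (fcompose G H) => t x) e))
    (fun x y f => fmap H f)
    (fun x => fmap_id H x) (fun x y z g f => fmap_comp H g f).

End Equifier.

(* Main.v *)
(** Let [theta] be a large cardinal, presented as the type of binary trees over
    a small type [Z], and let a poset be theta-directed when every family
    indexed by [theta] is bounded. An object of an accessible category with
    directed colimits is the colimit of a lambda-directed diagram on [P] of
    lambda-presentable objects. Since all directed colimits exist, one may take
    the colimits of its restrictions to the merely directed subsets of [P] of
    size at most [theta]: they are theta^+-presentable, they form a
    theta-directed diagram with the same colimit, and this diagram is continuous
    along countable chains. For an inserter, the partial solutions
    [F (Y t) -> G (Y t)] of a given [F x -> G x] are theta-directed and cofinal: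
    presentability of [F (Y t)] yields maps [F (Y t) -> G (Y t')], compatible up
    to increasing [t'], and the supremum of an omega-chain of such steps is a
    solution. Equifiers are treated in the same way, products by products of
    posets, and directed colimits in all three are computed in the base. *)
From mathcomp Require Import all_boot.
From mathcomp Require Import boolp classical_sets functions cardinality.
Require Import Defs.

Set Implicit Arguments.
Unset Strict Implicit.
Unset Printing Implicit Defensive.

Local Open Scope classical_set_scope.
Local Open Scope card_scope.
Local Open Scope cat_scope.

(** * Cardinals *)

Definition embeds (A B : Type) : Prop := exists f : A -> B, injective f.

Lemma embeds_trans B A C : embeds A B -> embeds B C -> embeds A C.
Proof. by move=> [f fI] [g gI]; exists (g \o f); apply: inj_comp. Qed.

Lemma sval_inj (A : Type) (P : A -> Prop) : injective (@sval A P).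
Proof. by move=> [x Px] [y Py] /= xy; apply: eq_exist. Qed.

Lemma embeds_sig (A : Type) (P : A -> Prop) : embeds {x | P x} A.
Proof. by exists sval; apply: sval_inj. Qed.

Lemma embeds_surj (A B : Type) (f : A -> B) :
  (forall b, exists a, f a = b) -> embeds B A.
Proof.
by move=> /choice[g gK]; exists g => b b' /(congr1 f); rewrite !gK.
Qed.

(** Proof irrelevance turns the equality of first components into [erefl], so the transport between
    the second components is trivial. *)
Lemma existT_inj (A : Type) (B : A -> Type) (a : A) (b b' : B a) :
  existT B a b = existT B a b' -> b = b'.
Proof.
by move=> e; have := projT2_eq e; rewrite (Prop_irrelevance (projT1_eq e) erefl).
Qed.

Lemma dep_choice (A : Type) (B : A -> Type) (P : forall a, B a -> Prop) :
  (forall a, exists b, P a b) -> exists f, forall a, P a (f a).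
Proof. by move=> h; exists (fun a => sval (cid (h a))) => a; case: cid. Qed.

(** Reduces cardinal comparison to injections between types, the only form used afterwards. *)
Lemma card_le_embeds (T U : Type) (A : set T) (B : set U) :
  A #<= B <-> embeds {x | A x} {x | B x}.
Proof.
split=> [/card_leP[f]|[f fI]].
  have fI : injective f by move=> x y; apply: inj => //; rewrite inE.
  exists (fun x => let y := f (exist _ (sval x) (mem_set (svalP x))) in
    exist _ (sval y) (set_mem (svalP y))).
  by move=> x y /(congr1 sval) /val_inj /fI /(congr1 sval) xy; apply: sval_inj.
pose g (x : A) : B := let y := f (exist _ (sval x) (set_mem (svalP x))) in
  exist _ (sval y) (mem_set (svalP y)).
have gI : {in [set: A] &, injective g}.
  move=> x y _ _ /(congr1 sval) /(@sval_inj _ B) e.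
  by apply: val_inj; have /(congr1 sval) := fI _ _ e.
have gF : set_fun [set: A] [set: B] g by [].
by apply/card_leP/injfunPex; exists g.
Qed.

Lemma setT_embeds U : embeds {x | [set: U] x} U /\ embeds U {x | [set: U] x}.
Proof.
split; first exact: embeds_sig.
by exists (fun u => exist _ u I) => u v [].
Qed.

Lemma card_lt_embeds (T U : Type) (A : set T) :
  card_lt A [set: U] <-> embeds {x | A x} U /\ ~ embeds U {x | A x}.
Proof.
have [U1 U2] := setT_embeds U.
rewrite /card_lt !card_le_embeds; split=> -[AU UA]; split.
- exact: embeds_trans AU U1.
- by move=> h; apply: UA; apply: embeds_trans h.
- exact: embeds_trans AU U2.
- by move=> h; apply: UA; apply: embeds_trans h.
Qed.

Lemma card_ltT_embeds (A U : Type) :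
  card_lt [set: A] [set: U] <-> embeds A U /\ ~ embeds U A.
Proof.
have [A1 A2] := setT_embeds A; rewrite card_lt_embeds; split=> -[AU UA]; split.
- exact: embeds_trans AU.
- by move=> h; apply: UA; apply: embeds_trans A2.
- exact: embeds_trans AU.
- by move=> h; apply: UA; apply: embeds_trans A1.
Qed.

(* A maximal set of choice functions on which every evaluation is injective
   projects onto some X i, and this X i has minimal cardinality. *)
Lemma min_cardinal (I : Type) (X : I -> Type) : inhabited I ->
  exists i, forall j, embeds (X i) (X j).
Proof.
move=> [i0]; pose P (S : set (forall i, X i)) :=
  forall i s t, S s -> S t -> s i = t i -> s = t.
have [|S [PS maxS]] := @Zorn_bigcup _ P.
  move=> F FP totF i s t [A FA As] [B FB Bt].
  by case: (totF _ _ FA FB) => AB; [apply: (FP _ FB)|apply: (FP _ FA)] => //;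
    apply: AB.
have [i Si] : exists i, forall x : X i, exists s, S s /\ s i = x.
  apply: contrapT => /forallNP nS.
  have /dep_choice[x xP] : forall i, exists x : X i, forall s, S s -> s i <> x.
    move=> i; have /existsNP[x nx] := nS i.
    by exists x => s Ss sx; apply: nx; exists s.
  apply: (maxS (S `|` [set x])).
    by split; [left|move=> /(_ x (or_intror erefl)) Sx; apply: (xP i0 x)].
  move=> i s t [Ss|->] [St|->] // e; first exact: PS e.
  - by case: (xP _ _ Ss e).
  - by case: (xP _ _ St (esym e)).
have {Si}/dep_choice[s sP] := Si.
exists i => j; exists (fun x => s x j) => x y /PS e.
have {e} e : s x = s y by apply: e; apply: (sP _).1.
by rewrite -(sP x).2 -(sP y).2 e.
Qed.

(** Comparability of cardinals is [min_cardinal] for a family indexed by [bool]. *)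
Lemma embeds_total A B : embeds A B \/ embeds B A.
Proof.
have [[] h] := @min_cardinal bool (fun b => if b then A else B) (inhabits true).
  by left; apply: (h false).
by right; apply: (h true).
Qed.

(* A small type of cardinality at least that of [Z] that is closed, by
   construction, under countable sums and under pairing, so that no cardinal
   arithmetic is needed. [Quote] separates the leaves of [closure] from its
   nodes. *)
Inductive tree (Z : small) : small :=
| Root
| Atom of Z
| Quote of tree Z
| Pair of tree Z & tree Z.
Arguments Root {Z}.

Lemma embeds_atom (Z A : small) : embeds A Z -> embeds A (tree Z).
Proof. by move=> [f fI]; exists (fun a => Atom (f a)) => a b [] /fI. Qed.

Lemma embeds_nat (Z : small) : embeds nat (tree Z).
Proof.
exists (fun n => iter n (@Quote Z) Root).
by elim=> [|n IH] [|m] //= [] /IH ->.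
Qed.

Lemma embeds_sigma (Z A : small) (B : A -> small) : embeds A (tree Z) ->
  (forall a, embeds (B a) (tree Z)) -> embeds {a : A & B a} (tree Z).
Proof.
move=> [f fI] /dep_choice[g gI].
exists (fun x => Pair (f (projT1 x)) (g _ (projT2 x))) => -[a b] [a' b'] /= [].
by move=> /fI e; subst a' => /gI ->.
Qed.

Lemma embeds_pair (Z A B : small) : embeds A (tree Z) ->
  embeds B (tree Z) -> embeds (A * B) (tree Z).
Proof.
move=> [f fI] [g gI]; exists (fun x => Pair (f x.1) (g x.2)).
by move=> [a b] [a' b'] /= [] /fI -> /gI ->.
Qed.

Lemma cantor (A : Type) : ~ embeds (set A) A.
Proof.
move=> [f fI]; pose D := [set a | exists2 S, f S = a & ~ S a].
have nD : ~ D (f D) by move=> Df; have [S /fI ->] := Df.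
by apply: (nD); exists D.
Qed.

(** [M] is the successor cardinal of [tree Z]: a minimal one among the subsets of its powerset that
    do not embed in it. The cardinals below [M] are those that embed in [tree Z], so regularity is
    the closure of [tree Z] under sums, [embeds_sigma]. *)
Lemma succ_cardinal (Z : small) : exists2 M : small, regular_cardinal M &
  forall (T : small) (S : set T),
    card_lt S [set: M] <-> embeds {x | S x} (tree Z).
Proof.
pose W := set (tree Z).
pose I := {A : set W | ~ embeds {w | A w} (tree Z)}.
have I0 : inhabited I.
  split; exists setT => h; apply: (@cantor (tree Z)).
  by apply: embeds_trans h; apply: (setT_embeds _).2.
have [[M0 nM] Mmin] := @min_cardinal I (fun A => {w | sval A w}) I0.
pose M : small := {w | M0 w}.
have {}Mmin (A : set W) : ~ embeds {w | A w} (tree Z) -> embeds M {w | A w}.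
  by move=> nA; exact: (Mmin (exist _ A nA)).
have {}nM : ~ embeds M (tree Z) := nM.
have ltM (A : small) : embeds A M /\ ~ embeds M A <-> embeds A (tree Z).
  split=> [[[f fI] MA]|AZ]; last first.
    split; last by move=> MA; apply: nM; apply: embeds_trans AZ.
    apply: embeds_trans AZ _.
    by case: (embeds_total (tree Z) M).
  (* If [A] did not embed in [tree Z], neither would its image in [W], and minimality would embed
     [M] in that image, hence in [A]. *)
  apply: contrapT => nA; apply: MA.
  pose A' := [set w | exists a, sval (f a) = w].
  have A'A : embeds {w | A' w} A.
    apply: (@embeds_surj _ _ (fun a => exist A' (sval (f a)) (ex_intro _ a erefl))).
    by move=> [w [a aw]]; exists a; apply: sval_inj.
  have nA' : ~ embeds {w | A' w} (tree Z).
    move=> h; apply: nA; apply: embeds_trans h.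
    exists (fun a => exist A' (sval (f a)) (ex_intro _ a erefl)) => a b [].
    by move=> e; apply: fI; apply: sval_inj.
  exact: embeds_trans (Mmin _ nA') A'A.
exists M; last by move=> T S; rewrite card_lt_embeds ltM.
split.
  apply/infiniteP/card_le_embeds.
  apply: embeds_trans (setT_embeds _).1 _.
  apply: embeds_trans (setT_embeds _).2.
  by have [] := (ltM nat).2 (embeds_nat Z).
move=> J X /card_ltT_embeds/ltM JZ XZ; apply/card_ltT_embeds/ltM.
by apply: embeds_sigma => // j; apply/ltM/card_ltT_embeds.
Qed.

(** Reindexes a family over [A] by [B]; the inhabitant of [C] is the default value off the image of
    the injection. It is used with [B] equal to [tree Z]. *)
Lemma embeds_cover (A B C : Type) (f : A -> C) : inhabited C -> embeds A B ->
  exists g : B -> C, forall a, exists b, g b = f a.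
Proof.
move=> [c0] [h hI].
have /choice[g gP] : forall b, exists c, forall a, h a = b -> c = f a.
  move=> b; case: (pselect (exists a, h a = b)) => [[a <-]|nb].
    by exists (f a) => a' /hI ->.
  by exists c0 => a ab; case: nb; exists a.
by exists g => a; exists (h a); apply: gP.
Qed.

(** * Directed colimits and presentable objects *)

(** Directedness for the successor of [tree Z], stated with families instead of subsets so that
    bounds are obtained without forming images; [tdirectedE] relates the two forms. *)
Definition tdirected (Z : small) (P : Poset) : Prop :=
  forall (A : small) (e : A -> carrier P), embeds A (tree Z) ->
    exists u, forall a, ple (e a) u.

Lemma tdirected_bound (Z : small) (P : Poset) (p : carrier P) (A : small)
    (e : A -> carrier P) : tdirected Z P -> embeds A (tree Z) ->
  exists u, ple p u /\ forall a, ple (e a) u.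
Proof.
move=> dP [h hI].
have [|u uP] := dP (option A) (fun o => if o is Some a then e a else p).
  (* [Root] codes the extra point, and [Quote] keeps the codes of [A] away from it. *)
  exists (fun o => if o is Some a then Quote (h a) else Root).
  by move=> [a|] [b|] //= [] /hI ->.
by exists u; split=> [|a]; [apply: (uP None)|apply: (uP (Some a))].
Qed.

Lemma tdirectedE (Z M : small) (P : Poset) :
  (forall (T : small) (S : set T),
    card_lt S [set: M] <-> embeds {x | S x} (tree Z)) ->
  lambda_directed M P <-> tdirected Z P.
Proof.
move=> ltM; split=> [dP A e AZ|dP S /ltM SZ]; last first.
  have [u uP] := dP _ sval SZ.
  by exists u => x Sx; apply: (uP (exist _ x Sx)).
have [|u uP] := dP (range e); last by exists u => a; apply: uP; exists a.
apply/ltM; apply: embeds_trans AZ.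
have re a : range e (e a) by exists a.
apply: (@embeds_surj _ _ (fun a => exist (range e) _ (re a))) => -[x [a aT ax]].
by exists a; apply: sval_inj.
Qed.

Lemma tdirected_lambda (Z lambda : small) (P : Poset) :
  embeds lambda (tree Z) -> tdirected Z P -> lambda_directed lambda P.
Proof.
move=> lZ dP S /card_lt_embeds[Sl _].
have [u uP] := dP _ sval (embeds_trans Sl lZ).
by exists u => x Sx; apply: (uP (exist _ x Sx)).
Qed.

Lemma lambda_directedW (lambda : small) (P : Poset) :
  infinite_set [set: lambda] -> lambda_directed lambda P -> directed P.
Proof.
move=> linf dP.
have fin (S : set (carrier P)) : finite_set S -> card_lt S [set: lambda].
  move=> Sfin; split; last by move=> /card_le_finite/(_ Sfin).
  by apply: card_le_trans (finite_set_countable Sfin) _; apply/infiniteP.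
split=> [|x y].
  by have [u _] := dP _ (fin _ (finite_set0 _)).
have [u uP] := dP _ (fin _ (finite_set2 x y)).
by exists u; split; apply: uP; [left|right].
Qed.

Lemma tdirectedW (Z : small) (P : Poset) : tdirected Z P -> directed P.
Proof.
move=> dP; split=> [|x y].
  have [|u _] := dP False (fun f => match f with end); last by [].
  by exists (fun f : False => match f with end) => -[].
have [|u uP] := dP bool (fun b => if b then x else y).
  exists (fun b => if b then Root else Quote Root).
  by move=> [] [].
by exists u; split; [apply: (uP true)|apply: (uP false)].
Qed.

(** An unbundled [is_colimit], with legs as plain families: cocones can be restricted, composed and
    reindexed without rebuilding records. *)
Definition colim (P : Poset) (C : Cat) (X : Functor (poset_cat P) C) (x : C)
    (l : forall p : carrier P, Hom (X p) x) : Prop :=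
  (forall p q (u : ple p q), l q \oc fmap X u = l p) /\
  forall y (m : forall p : carrier P, Hom (X p) y),
    (forall p q (u : ple p q), m q \oc fmap X u = m p) ->
    exists! h : Hom x y, forall p, h \oc l p = m p.

Section Colim.
Variables (P : Poset) (C : Cat) (X : Functor (poset_cat P) C) (x : C).
Variable l : forall p : carrier P, Hom (X p) x.
Hypothesis Xx : colim l.

Lemma colim_compat p q (u : ple p q) : l q \oc fmap X u = l p.
Proof. exact: Xx.1. Qed.

Lemma colim_desc y (m : forall p : carrier P, Hom (X p) y) :
  (forall p q (u : ple p q), m q \oc fmap X u = m p) ->
  exists h : Hom x y, forall p, h \oc l p = m p.
Proof. by move=> /(Xx.2)[h [hP _]]; exists h. Qed.

Lemma colim_ext y (h k : Hom x y) :
  (forall p, h \oc l p = k \oc l p) -> h = k.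
Proof.
move=> hk; have [|g [_ gP]] := Xx.2 y (fun p => k \oc l p).
  by move=> p q u; rewrite -ccompA colim_compat.
by rewrite -(gP h hk) -(gP k).
Qed.

End Colim.

Lemma colimI (P : Poset) (C : Cat) (X : Functor (poset_cat P) C) (x : C)
    (l : forall p : carrier P, Hom (X p) x) :
  (forall p q (u : ple p q), l q \oc fmap X u = l p) ->
  (forall y (m : forall p : carrier P, Hom (X p) y),
    (forall p q (u : ple p q), m q \oc fmap X u = m p) ->
    exists h : Hom x y, forall p, h \oc l p = m p) ->
  (forall y (h k : Hom x y), (forall p, h \oc l p = k \oc l p) -> h = k) ->
  colim l.
Proof.
move=> lc ld lu; split=> // y m /ld[h hP].
by exists h; split=> // k kP; apply: lu => p; rewrite hP kP.
Qed.

Lemma is_colimitE (P : Poset) (C : Cat) (X : Functor (poset_cat P) C)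
  (c : Cocone X) : is_colimit c <-> colim (leg c).
Proof.
split=> [cP|[_ cP] [y m mc]]; last exact: cP.
split; first exact: (@leg_compat (poset_cat P) C X c).
by move=> y m mc; exact: (cP (@MkCocone (poset_cat P) C X y m mc)).
Qed.

Lemma colim_is_colimit (P : Poset) (C : Cat) (X : Functor (poset_cat P) C) x
    (l : forall p : carrier P, Hom (X p) x) (Xx : colim l) :
  is_colimit (MkCocone (Xx.1 : forall i j (u : @Hom (poset_cat P) i j), _)).
Proof. exact/is_colimitE. Qed.

Lemma has_directed_colim (C : Cat) : has_directed_colimits C ->
  forall (P : Poset) (X : Functor (poset_cat P) C), directed P ->
  exists x (l : forall p : carrier P, Hom (X p) x), colim l.
Proof.
move=> hC P X dP; have [c /is_colimitE cP] := hC P dP X.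
by exists (apex c), (leg c).
Qed.

Definition preserves (C D : Cat) (F : Functor C D) : Prop :=
  forall (P : Poset) (X : Functor (poset_cat P) C) x
    (l : forall p : carrier P, Hom (X p) x),
  directed P -> colim l -> colim (X := fcompose F X) (fun p => fmap F (l p)).

Lemma preservesE (C D : Cat) (F : Functor C D) :
  preserves_directed_colimits F <-> preserves F.
Proof.
split=> [pF P X x l dP Xx|pF P dP X c /is_colimitE cP].
  by have /is_colimitE := pF _ dP _ _ (colim_is_colimit Xx).
by apply/is_colimitE; apply: (pF _ _ _ _ dP cP).
Qed.

(** Elementwise presentability: a map into a colimit factors through some stage, and two
    factorizations through the same stage agree later on. *)
Definition pres (Z : small) (C : Cat) (x : C) : Prop :=
  forall (P : Poset) (X : Functor (poset_cat P) C) y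
    (l : forall p : carrier P, Hom (X p) y),
  tdirected Z P -> colim l ->
  (forall f : Hom x y, exists p (g : Hom x (X p)), l p \oc g = f) /\
  (forall p (g g' : Hom x (X p)), l p \oc g = l p \oc g' ->
    exists q (u : ple p q), fmap X u \oc g = fmap X u \oc g').

Lemma fmapK (P : Poset) (C : Cat) (X : Functor (poset_cat P) C) p q r
    (u : ple p q) (v : ple q r) (w : ple p r) :
  fmap X v \oc fmap X u = fmap X w.
Proof. by rewrite -(@fmap_comp _ _ X p q r v u); congr (fmap X _);
  exact: (@Prop_irrelevance (ple p r)). Qed.

Lemma fmap1 (P : Poset) (C : Cat) (X : Functor (poset_cat P) C) p
    (u : ple p p) : fmap X u = idc (X p).
Proof.
by rewrite -(@fmap_id _ _ X p); congr (fmap X _);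
  exact: (@Prop_irrelevance (ple p p)).
Qed.

(* Testing the colimit of hom-sets against cocones with vertex [Prop]. *)
Lemma presentable_pres (Z lambda : small) (C : Cat) (x : C) :
  embeds lambda (tree Z) -> presentable lambda x -> pres Z x.
Proof.
move=> lZ xP P X y l dP Xy.
have [zd dir] := tdirectedW dP.
have /is_colimitE hP := xP _ (tdirected_lambda lZ dP) _ _ (colim_is_colimit Xy).
split=> [f|p g g' gg'].
  pose h (f : Hom x y) : Prop := exists p (g : Hom x (X p)), l p \oc g = f.
  have e : h = fun=> True.
    apply: (colim_ext hP (y := Prop : set_cat)) => p; apply: funext => g /=.
    by apply/propext; split=> // _; exists p, g.
  by have : h f by rewrite e.
(* [m q k] says that [k] and [g] become equal at a later stage. It descends to a predicate on
   [Hom x y], which cannot separate [g] from [g']. *)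
pose m q (k : Hom x (X q)) : Prop := exists r (u : ple p r) (v : ple q r),
  fmap X u \oc g = fmap X v \oc k.
have [|h hm] := colim_desc hP (y := Prop : set_cat) (m := m).
  move=> q r u; apply: funext => k; apply/propext; split=> /= -[s [a [b ab]]].
    exists s, a, (ple_trans u b).
    by rewrite ab ccompA (fmapK _ _ _ (ple_trans u b)).
  have [t [st rt]] := dir s r.
  exists t, (ple_trans a st), rt.
  rewrite -(fmapK X a st) -ccompA ab !ccompA.
  by rewrite (fmapK X b st (ple_trans b st)) (fmapK X u rt (ple_trans b st)).
have h1 : h (l p \oc g) = m p g by rewrite -hm.
have h2 : h (l p \oc g) = m p g' by rewrite gg' -hm.
have : m p g' by rewrite -h2 h1; exists p, (ple_refl p), (ple_refl p).
move=> [r [u [v uv]]]; exists r, u.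
by rewrite uv (Prop_irrelevance u v).
Qed.

(** A cocone on the hom-sets extends to [Hom x (apex c)] by evaluation at a chosen factorization;
    the second half of [pres] makes the value independent of the choice. *)
Lemma pres_presentable (Z M : small) (C : Cat) (x : C) :
  (forall P, lambda_directed M P -> tdirected Z P) ->
  pres Z x -> presentable M x.
Proof.
move=> MZ xP P /MZ dP X c /is_colimitE cP; apply/is_colimitE.
have [_ dir] := tdirectedW dP.
have [xf xi] := xP _ _ _ _ dP cP.
have {xf} [s sP] : exists s : Hom x (apex c) -> {p & Hom x (X p)},
    forall f, leg c _ \oc projT2 (s f) = f.
  have /choice[s sP] : forall f, exists s : {p & Hom x (X p)},
      leg c _ \oc projT2 s = f.
    by move=> f; have [p [g gf]] := xf f; exists (existT _ p g).
  by exists s.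
apply: colimI => /=.
- by move=> p q u; apply: funext => g /=; rewrite ccompA (colim_compat cP).
- move=> Y m mc; exists (fun f => m _ (projT2 (s f))) => p; apply: funext => g /=.
  case: (s _) (sP (leg c p \oc g)) => q k /= e.
  have [r [pr qr]] := dir p q.
  have [|t [rt]] := xi r (fmap X qr \oc k) (fmap X pr \oc g).
    by rewrite !ccompA !(colim_compat cP).
  rewrite !ccompA !(fmapK X _ _ (ple_trans _ rt)) => kg.
  have := congr1 (m t) kg.
  have := mc q t (ple_trans qr rt); rewrite funeqE => /(_ k)/= -> .
  by have := mc p t (ple_trans pr rt); rewrite funeqE => /(_ g)/= -> .
- move=> Y h k hk; apply: funext => f; rewrite -(sP f).
  by have := hk (projT1 (s f)); rewrite funeqE => /(_ (projT2 (s f))).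
Qed.

(** * Objects generated by small directed diagrams *)

Lemma pres_iso (Z : small) (C : Cat) (x y : C) :
  isomorphic x y -> pres Z x -> pres Z y.
Proof.
move=> [f [g [gf fg]]] xP P X z l dP Xz; have [xf xi] := xP _ _ _ _ dP Xz.
split=> [h|p h h' hh'].
  have [p [k kh]] := xf (h \oc f); exists p, (k \oc g).
  by rewrite ccompA kh -ccompA fg ccomp_id_r.
have [|q [u uhh']] := xi p (h \oc f) (h' \oc f).
  by rewrite !ccompA hh'.
exists q, u; have := congr1 (fun k => k \oc g) uhh'.
by rewrite -!ccompA fg !ccomp_id_r.
Qed.

(** Colimits of at most [tree Z] many presentables are presentable: the factorizations of all legs,
    and then all the equations between them, are brought to a common stage. *)
Lemma pres_colim (Z : small) (N : Poset) (C : Cat) (X : Functor (poset_cat N) C)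
    (x : C) (l : forall n : carrier N, Hom (X n) x) :
  embeds (carrier N) (tree Z) -> (forall n : carrier N, pres Z (X n)) ->
  colim l -> pres Z x.
Proof.
move=> NZ XP Xx P Y y k dP Yy; split=> [f|p g g' gg'].
  have /dep_choice[i iP] (n : carrier N) : exists s : {p : carrier P & Hom (X n) (Y p)},
      k _ \oc projT2 s = f \oc l n.
    have [fac _] := XP n _ _ _ _ dP Yy.
    by have [p [g gf]] := fac (f \oc l n); exists (existT _ p g).
  have [p pP] := dP _ (fun n : carrier N => projT1 (i n)) NZ.
  have [g gP] : exists g : forall n : carrier N, Hom (X n) (Y p),
      forall n, k p \oc g n = f \oc l n.
    exists (fun n => fmap Y (pP n) \oc projT2 (i n)) => n.
    by rewrite ccompA (colim_compat Yy).
  (* The [g n] are compatible only after composition with [k p]. Each comparable pair of indices has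
     a stage where its triangle commutes, and the pairs again embed in [tree Z]. *)
  have /dep_choice[r rP] (s : {s : carrier N * carrier N | ple s.1 s.2}) :
      exists q, exists w : ple p q,
      fmap Y w \oc (g (sval s).2 \oc fmap X (svalP s)) = fmap Y w \oc g (sval s).1.
    have [_ inj] := XP (sval s).1 _ _ _ _ dP Yy.
    have [|q [w wP]] := inj p (g (sval s).2 \oc fmap X (svalP s)) (g (sval s).1).
      by rewrite ccompA !gP -ccompA (colim_compat Xx).
    by exists q, w.
  have RZ : embeds {s : carrier N * carrier N | ple s.1 s.2} (tree Z).
    by apply: embeds_trans (embeds_sig _) _; apply: embeds_pair.
  have [q [pq qP]] := tdirected_bound p r dP RZ.
  have [|h hP] := colim_desc Xx (m := fun n => fmap Y pq \oc g n).
    move=> n n' u; pose s := exist (fun s => ple s.1 s.2) (n, n') u.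
    have [w] := rP s; have := qP s => wq.
    rewrite (Prop_irrelevance (svalP s) u) /= => e.
    by rewrite -(fmapK _ w wq) -!ccompA e.
  exists q, h; apply: (colim_ext Xx) => n.
  by rewrite -ccompA hP ccompA (colim_compat Yy).
have /dep_choice[r rP] (n : carrier N) : exists q, exists w : ple p q,
    fmap Y w \oc (g \oc l n) = fmap Y w \oc (g' \oc l n).
  have [_ inj] := XP n _ _ _ _ dP Yy.
  have [|q [w wP]] := inj p (g \oc l n) (g' \oc l n); first by rewrite !ccompA gg'.
  by exists q, w.
have [q [pq qP]] := tdirected_bound p r dP NZ.
exists q, pq; apply: (colim_ext Xx) => n.
have [w] := rP n; have := qP n => wq e.
by rewrite -(fmapK _ w wq) -!ccompA e.
Qed.

Definition gen (Z : small) (C : Cat) (J : small) (A : J -> C) (x : C) : Prop :=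
  exists (P : Poset) (X : Functor (poset_cat P) C)
      (l : forall p : carrier P, Hom (X p) x),
    [/\ directed P, embeds (carrier P) (tree Z),
        forall p : carrier P, exists j, isomorphic (X p) (A j) & colim l].

Lemma isomorphic_sym (C : Cat) (x y : C) : isomorphic x y -> isomorphic y x.
Proof. by move=> [f [g [gf fg]]]; exists g, f. Qed.

Lemma isomorphic_fmap (C D : Cat) (F : Functor C D) (x y : C) :
  isomorphic x y -> isomorphic (F x) (F y).
Proof.
move=> [f [g [gf fg]]]; exists (fmap F f), (fmap F g).
by rewrite -!fmap_comp gf fg !fmap_id.
Qed.

Lemma gen_pres (Z : small) (C : Cat) (J : small) (A : J -> C) (x : C) :
  (forall j, pres Z (A j)) -> gen Z A x -> pres Z x.
Proof.
move=> AP [P [X [l [_ PZ XA Xx]]]]; apply: pres_colim PZ _ Xx => p.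
by have [j /isomorphic_sym jp] := XA p; apply: pres_iso jp _.
Qed.

Lemma gen_fmap (Z : small) (C D : Cat) (F : Functor C D) (J : small)
    (A : J -> C) (x : C) :
  preserves F -> gen Z A x -> gen Z (fun j => F (A j)) (F x).
Proof.
move=> FP [P [X [l [dP PZ XA Xx]]]].
exists P, (fcompose F X), (fun p => fmap F (l p)); split=> // [p|].
  by have [j jp] := XA p; exists j; apply: (isomorphic_fmap F jp).
exact: FP.
Qed.

(** * Generated objects form a set up to isomorphism *)

Section Codes.
Variables (Z : small) (C : Cat) (J : small) (A : J -> C).

(** A presentation by generators and relations, indexed by the fixed type [tree Z]. Unlike the
    diagrams in [gen], the presentations form a small type. *)
Definition code : small := {j : tree Z -> J &
  forall a b, Hom (A (j a)) (A (j b)) -> Prop}.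

Definition code_compat (c : code) (y : C)
    (m : forall a, Hom (A (projT1 c a)) y) : Prop :=
  forall a b h, projT2 c a b h -> m b \oc h = m a.

Definition codes (c : code) (x : C) : Prop :=
  exists l : forall a, Hom (A (projT1 c a)) x, code_compat l /\
    forall y (m : forall a, Hom (A (projT1 c a)) y), code_compat m ->
      exists! h : Hom x y, forall a, h \oc l a = m a.

Lemma codes_iso c x y : codes c x -> codes c y -> isomorphic x y.
Proof.
move=> [l [lc lu]] [m [mc mu]].
have [f [fP _]] := lu _ _ mc; have [g [gP _]] := mu _ _ lc.
exists f, g; split.
  have [h [_ hP]] := lu _ _ lc; rewrite -(hP (g \oc f)).
    by apply: hP => a; rewrite ccomp_id_l.
  by move=> a; rewrite -ccompA fP gP.
have [h [_ hP]] := mu _ _ mc; rewrite -(hP (f \oc g)).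
  by apply: hP => a; rewrite ccomp_id_l.
by move=> a; rewrite -ccompA gP fP.
Qed.

(** The diagram is reindexed along a surjection [e] from [tree Z], and its maps are conjugated into
    maps between members of [A]. Repeated indices are harmless: reflexivity puts relations between
    all names of one point. *)
Lemma gen_codes x : gen Z A x -> exists c, codes c x.
Proof.
move=> [P [X [l [[P0 _] PZ XA Xx]]]].
have [e eP] := embeds_cover id P0 PZ.
have [j jP] := choice XA.
have /dep_choice[s sP] : forall p, exists s : Hom (X p) (A (j p)) * Hom (A (j p)) (X p),
    s.2 \oc s.1 = idc _ /\ s.1 \oc s.2 = idc _.
  by move=> p; have [f [g fg]] := jP p; exists (f, g).
pose c : code := existT _ (fun a => j (e a)) (fun a b h =>
  exists u : ple (e a) (e b), h = (s (e b)).1 \oc fmap X u \oc (s (e a)).2).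
exists c; exists (fun a => l (e a) \oc (s (e a)).2); split.
  move=> a b h [u ->]; rewrite !ccompA -(ccompA _ (s (e b)).2) (sP _).1 ccomp_id_r.
  by rewrite (colim_compat Xx).
move=> y m mc.
have mP a b (u : ple (e a) (e b)) :
    m b \oc (s (e b)).1 \oc fmap X u = m a \oc (s (e a)).1.
  rewrite -(mc a b _ (ex_intro _ u erefl)) -!ccompA (sP (e a)).1.
  by rewrite ccomp_id_r.
have [t tP] := choice eP.
(* Composing with the transition map along this inequality avoids transporting objects along the
   equation [e (t p) = p]. *)
have et p : ple p (e (t p)) by rewrite tP; apply: ple_refl.
have [|h hP] := colim_desc Xx
    (m := fun p => m (t p) \oc (s (e (t p))).1 \oc fmap X (et p)).
  move=> p q u; rewrite -ccompA.
  rewrite (fmapK _ _ _ (ple_trans u (et q))).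
  have v : ple (e (t p)) (e (t q)) by rewrite !tP.
  by rewrite -(mP _ _ v) -[in RHS]ccompA (fmapK _ _ _ (ple_trans u (et q))).
have hm a : h \oc (l (e a) \oc (s (e a)).2) = m a.
  rewrite ccompA hP.
  rewrite (mP _ _ (et _)) -ccompA (sP _).2; exact: ccomp_id_r.
exists h; split=> // k kP; apply: (colim_ext Xx) => p.
rewrite -(colim_compat Xx (et p)) !ccompA; congr (_ \oc _).
have := congr1 (fun f => f \oc (s (e (t p))).1) (hm (t p)).
rewrite -(kP (t p)) -!ccompA (sP _).1 !ccomp_id_r; exact.
Qed.

(** One object is chosen for each code of a generated object; objects with the same code are
    isomorphic. *)
Lemma gen_small : exists (K : small) (B : K -> C),
  (forall k, gen Z A (B k)) /\ forall x, gen Z A x -> exists k, isomorphic x (B k).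
Proof.
pose K : small := {c : code | exists x, gen Z A x /\ codes c x}.
exists K, (fun k : K => sval (cid (svalP k))); split=> [k|x gx].
  by case: cid => x [].
have [c cx] := gen_codes gx.
exists (exist _ c (ex_intro _ x (conj gx cx))).
by case: cid => y [_ /= cy]; apply: codes_iso cx cy.
Qed.

End Codes.

(** * Resolution by a highly directed diagram *)

Definition mono_functor (Q P : Poset) (s : carrier Q -> carrier P)
  (sm : forall i j, ple i j -> ple (s i) (s j)) :
  Functor (poset_cat Q) (poset_cat P).
Proof.
refine (@MkFunctor (poset_cat Q) (poset_cat P) s sm _ _);
  by move=> *; apply: (@Prop_irrelevance (ple _ _)).
Defined.

Definition natP : Poset.
Proof.
refine (@MkPoset nat (fun i j => i <= j) leqnn (fun j i k => @leq_trans j i k) _).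
by move=> i j ij ji; apply/eqP; rewrite eqn_leq ij.
Defined.

Lemma natP_directed : directed natP.
Proof.
split=> [|i j]; first exact: (inhabits 0).
by exists (maxn i j); split=> /=; [apply: leq_maxl|apply: leq_maxr].
Qed.

Definition sub_poset (P : Poset) (S : carrier P -> Prop) : Poset.
Proof.
refine (@MkPoset {p | S p} (fun p q => ple (sval p) (sval q))
  (fun p => ple_refl (sval p))
  (fun q p r => @ple_trans P (sval q) (sval p) (sval r)) _).
by move=> p q pq qp; apply: sval_inj; apply: ple_anti.
Defined.

Definition restr (P : Poset) (C : Cat) (X : Functor (poset_cat P) C)
    (S : carrier P -> Prop) : Functor (poset_cat (sub_poset S)) C :=
  fcompose X (@mono_functor (sub_poset S) P sval (fun _ _ u => u)).

(** Asks for some upper bound of the chain whose value is the colimit, not for a least upper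
    bound. *)
Definition chain_continuous (T : Poset) (C : Cat)
    (Y : Functor (poset_cat T) C) : Prop :=
  forall (s : carrier natP -> carrier T)
    (sm : forall i j, ple i j -> ple (s i) (s j)),
  exists t (u : forall n, ple (s n) t),
    colim (X := fcompose Y (mono_functor sm)) (fun n => fmap Y (u n)).

Section Resolution.
Variables (Z : small) (P : Poset) (dP : directed P).
Notation T := (tree Z).

(** The directed subsets of [P] of size at most [tree Z]. Smallness is expressed as being the range
    of a map from [tree Z], which also makes the subset nonempty. *)
Record dsub : small := DSub {
  dset :> carrier P -> Prop;
  dset_small : exists e : T -> carrier P, dset = range e;
  dset_dir : forall x y, dset x -> dset y ->
    exists z, [/\ dset z, ple x z & ple y z] }.

Lemma dsub_inj : injective dset.
Proof.
move=> [A Ae Ad] [B Be Bd] /= AB; subst B.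
by rewrite (Prop_irrelevance Ae Be) (Prop_irrelevance Ad Bd).
Qed.

Definition dsub_poset : Poset.
Proof.
refine (@MkPoset dsub (fun A B => A `<=` B) (fun A => @subset_refl _ A)
  (fun B A C => @subset_trans _ B A C) _).
by move=> A B AB BA; apply/dsub_inj/seteqP.
Defined.

Lemma dsub_embeds (A : dsub) : embeds {p | A p} T.
Proof.
have [e Ae] := dset_small A.
have ae a : A (e a) by rewrite Ae; exists a.
apply: (@embeds_surj _ _ (fun a => exist A _ (ae a))) => -[p Ap].
have [a aT ap] : range e p by rewrite -Ae.
by exists a; apply: sval_inj.
Qed.

Lemma dsub_directed (A : dsub) : directed (sub_poset A).
Proof.
split=> [|[x Ax] [y Ay]].
  have [e Ae] := dset_small A.
  by split; exists (e Root); rewrite Ae; exists Root.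
have [z [Az xz yz]] := dset_dir Ax Ay.
by exists (exist _ z Az).
Qed.

(** Trees are read as formal terms: [Quote] yields a generator, [Pair] an upper bound, and all other
    trees the default [p0]. The set of values is thus closed under binary bounds while being indexed
    by [tree Z]. *)
Fixpoint closure (p0 : carrier P) (ub : carrier P -> carrier P -> carrier P)
    (e : T -> carrier P) (t : T) : carrier P :=
  match t with
  | Quote t => e t
  | Pair a b => ub (closure p0 ub e a) (closure p0 ub e b)
  | _ => p0
  end.

Lemma dsub_cover (A : Type) (f : A -> carrier P) : embeds A T ->
  exists S : dsub, forall a, S (f a).
Proof.
have [[p0] dir] := dP.
have /choice[ub ubP] (s : carrier P * carrier P) :
  exists z, ple s.1 z /\ ple s.2 z by exact: dir.
move=> /(embeds_cover f (inhabits p0))[e eP].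
pose S := range (closure p0 (fun x y => ub (x, y)) e).
have Sd x y : S x -> S y -> exists z, [/\ S z, ple x z & ple y z].
  move=> [a _ <-] [b _ <-]; exists (closure p0 (fun x y => ub (x, y)) e (Pair a b)).
  by have [] := ubP (closure p0 (fun x y => ub (x, y)) e a,
    closure p0 (fun x y => ub (x, y)) e b); split=> //; exists (Pair a b).
exists (@DSub S (ex_intro _ _ erefl) Sd) => a.
by have [t <-] := eP a; exists (Quote t).
Qed.

(** The union of the given sets need not be directed, but it is small enough for [dsub_cover] to
    enclose it. *)
Lemma dsub_tdirected : tdirected Z dsub_poset.
Proof.
move=> A e AZ.
have [|S SP] := @dsub_cover {a : A & {p | e a p}} (fun x => sval (projT2 x)).
  by apply: embeds_sigma => // a; apply: dsub_embeds.
by exists S => a p ap; apply: (SP (existT _ a (exist _ p ap))).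
Qed.

(** Countable unions of chains stay directed and small; this is the source of chain continuity. *)
Lemma dsub_chain (s : carrier natP -> dsub) :
  (forall i j, ple i j -> @ple dsub_poset (s i) (s j)) ->
  exists S : dsub, dset S = \bigcup_n s n.
Proof.
move=> sm.
have [[p0] _] := dP.
have NZ : embeds {n : nat & {p | s n p}} T.
  by apply: embeds_sigma => [|n]; [apply: embeds_nat|apply: dsub_embeds].
have [r0] := (dsub_directed (s 0)).1.
pose f (x : {n : nat & {p | s n p}}) := exist (fun p => exists n, s n p)
  (sval (projT2 x)) (ex_intro _ (projT1 x) (svalP (projT2 x))).
have U0 : inhabited {p | exists n, s n p} by split; exact: (f (existT _ 0 r0)).
have [e eP] := embeds_cover f U0 NZ.
have Ue : \bigcup_n s n = range (fun t => sval (e t)).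
  apply/seteqP; split=> [p [n _ np]|_ [t _ <-]].
    have [t te] := eP (existT _ n (exist _ p np)).
    by exists t => //; rewrite te.
  by have [n] := svalP (e t); exists n.
have Ud x y : (\bigcup_n s n) x -> (\bigcup_n s n) y ->
    exists z, [/\ (\bigcup_n s n) z, ple x z & ple y z].
  move=> [i _ ix] [j _ jy].
  have [z [? ? ?]] := dset_dir (sm i (maxn i j) (leq_maxl i j) _ ix)
    (sm j (maxn i j) (leq_maxr i j) _ jy).
  by exists z; split=> //; exists (maxn i j).
by exists (@DSub _ (ex_intro _ _ Ue) Ud).
Qed.

Variables (C : Cat) (hC : has_directed_colimits C) (X : Functor (poset_cat P) C).

(** The colimits of the restrictions are chosen first; uniqueness of the induced maps then makes the
    choice functorial. *)
Lemma dsub_colim : exists (Y : Functor (poset_cat dsub_poset) C)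
    (L : forall (S : dsub) (p : carrier (sub_poset S)), Hom (X (sval p)) (Y S)),
  (forall S : dsub, colim (X := restr X S) (L S)) /\
  forall (S S' : dsub) (u : @ple dsub_poset S S') p (Sp : S p),
    fmap Y u \oc L S (exist _ p Sp) = L S' (exist _ p (u p Sp)).
Proof.
have /dep_choice[y] : forall S : dsub, exists y (l : forall p : carrier (sub_poset S),
    Hom (X (sval p)) y), colim (X := restr X S) l.
  by move=> S; have := has_directed_colim hC (restr X S) (dsub_directed S).
move=> /dep_choice[L LP].
have /dep_choice[h hP] : forall s : {s : dsub * dsub | @ple dsub_poset s.1 s.2},
    exists h : Hom (y (sval s).1) (y (sval s).2), forall p Sp,
    h \oc L (sval s).1 (exist _ p Sp) = L (sval s).2 (exist _ p (proj2_sig s p Sp)).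
  move=> [[S S'] /= u].
  have [|h hP] := colim_desc (LP S)
    (m := fun p => L S' (exist _ (sval p) (u _ (proj2_sig p)))).
    move=> [p Sp] [q Sq] v.
    exact: (@colim_compat _ _ _ _ _ (LP S') (exist _ p (u p Sp)) (exist _ q (u q Sq)) v).
  by exists h => p Sp; apply: (hP (exist _ p Sp)).
pose hm S S' u := h (exist (fun s => @ple dsub_poset s.1 s.2) (S, S') u).
have hmP S S' u p Sp : hm S S' u \oc L S (exist _ p Sp) = L S' (exist _ p (u p Sp)).
  exact: hP.
have h1 S u : hm S S u = idc (y S).
  apply: (colim_ext (LP S)) => -[p Sp].
  by rewrite hmP ccomp_id_l (Prop_irrelevance (u p Sp) Sp).
have hc S S' S'' v u w : hm S S'' w = hm S' S'' v \oc hm S S' u.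
  apply: (colim_ext (LP S)) => -[p Sp].
  rewrite -ccompA (hmP S S'' w) (hmP S S' u) (hmP S' S'' v).
  by rewrite (Prop_irrelevance (v p (u p Sp)) (w p Sp)).
exists (@MkFunctor (poset_cat dsub_poset) C y hm (fun S => h1 S _)
  (fun S S' S'' v u => hc S S' S'' v u _)), L.
by split.
Qed.

Section Union.
Variables (Y : Functor (poset_cat dsub_poset) C).
Variable L : forall (S : dsub) (p : carrier (sub_poset S)), Hom (X (sval p)) (Y S).
Arguments L : clear implicits.
Hypothesis LP : forall S : dsub, colim (X := restr X S) (L S).
Hypothesis LY : forall (S S' : dsub) (u : @ple dsub_poset S S') p (Sp : S p),
  fmap Y u \oc L S (exist _ p Sp) = L S' (exist _ p (u p Sp)).
Variables (Q : Poset) (dQ : directed Q) (s : carrier Q -> dsub).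
Hypothesis sm : forall i j, ple i j -> @ple dsub_poset (s i) (s j).

(** A colimit over a directed union is the colimit of the colimits over its members. It serves for
    the union of all of [dsub_poset] and for unions of countable chains. *)
Lemma colim_bigcup (U : set (carrier P)) (z : C)
    (k : forall p : carrier (sub_poset U), Hom (X (sval p)) z)
    (g : forall q : carrier Q, Hom (Y (s q)) z) :
  (forall p, U p -> exists q, s q p) -> colim (X := restr X U) k ->
  (forall q p (qp : s q p) (Up : U p),
    g q \oc L (s q) (exist _ p qp) = k (exist _ p Up)) ->
  (forall q, s q `<=` U) ->
  colim (X := fcompose Y (@mono_functor Q dsub_poset s sm)) g.
Proof.
move=> cov Uz gk sU; have [_ dir] := dQ; apply: colimI => /=.
- move=> q q' u; apply: (colim_ext (LP (s q))) => -[p qp].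
  by rewrite -ccompA LY (gk q' p _ (sU _ _ qp)) (gk q p _ (sU _ _ qp)).
- move=> y m mc.
  (* The composite out of [X p] does not depend on the member of the union in which [p] is found. *)
  have mP q q' p (qp : s q p) (qp' : s q' p) :
      m q \oc L (s q) (exist _ p qp) = m q' \oc L (s q') (exist _ p qp').
    have [r [qr q'r]] := dir q q'.
    rewrite -(mc _ _ qr) -(mc _ _ q'r) -!ccompA !LY.
    by rewrite (Prop_irrelevance (sm q'r qp') (sm qr qp)).
  have /dep_choice[c cP] : forall p : carrier (sub_poset U), exists q, s q (sval p).
    by move=> [p Up]; apply: cov.
  have [|h hP] := colim_desc Uz
    (m := fun p => m (c p) \oc L (s (c p)) (exist _ _ (cP p))).
    move=> p p' u; have [r [cr cr']] := dir (c p) (c p').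
    rewrite (mP _ r _ _ (sm cr (cP p))) (mP _ r _ _ (sm cr' (cP p'))) -ccompA.
    congr (_ \oc _).
    exact: (@colim_compat _ _ _ _ _ (LP (s r)) (exist _ (sval p) (sm cr (cP p)))
      (exist _ (sval p') (sm cr' (cP p'))) u).
  exists h => q; apply: (colim_ext (LP (s q))) => -[p qp].
  rewrite -ccompA (gk _ _ _ (sU _ _ qp)).
  by apply: etrans (hP (exist _ p (sU _ _ qp))) _; apply: mP.
- move=> y h h' hh'; apply: (colim_ext Uz) => -[p Up].
  have [q qp] := cov p Up.
  by rewrite -(gk q p qp) !ccompA hh'.
Qed.

End Union.

Lemma resolution (J : small) (A : J -> C) x
    (l : forall p : carrier P, Hom (X p) x) :
  (forall p : carrier P, exists j, isomorphic (X p) (A j)) -> colim l ->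
  exists (Q : Poset) (Y : Functor (poset_cat Q) C)
      (k : forall q : carrier Q, Hom (Y q) x),
    [/\ tdirected Z Q, forall q : carrier Q, gen Z A (Y q), colim k
      & chain_continuous Y].
Proof.
move=> XA Xx; have [Y [L [LP LY]]] := dsub_colim.
have /dep_choice[k kP] : forall S : dsub, exists k : Hom (Y S) x,
    forall p, k \oc L S p = l (sval p).
  move=> S; apply: (colim_desc (LP S) (m := fun p => l (sval p))) => p q u.
  exact: (colim_compat Xx).
(* [colim_bigcup] speaks of restrictions to subsets, so [X] is viewed as its restriction to the full
   one. *)
have TU : colim (X := restr X setT) (fun p => l (sval p)).
  apply: colimI => [p q u|y m mc|y h h' hh'].
  - exact: (colim_compat Xx).
  - have [|h hP] := colim_desc Xx (m := fun p => m (exist _ p I)).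
      by move=> p q u; apply: (mc (exist _ p I) (exist _ q I)).
    by exists h => -[p []]; apply: hP.
  - by apply: (colim_ext Xx) => p; apply: (hh' (exist _ p I)).
exists dsub_poset, Y, k; split.
- exact: dsub_tdirected.
- move=> S; exists (sub_poset S), (restr X S), (L S); split.
  + exact: dsub_directed.
  + exact: dsub_embeds.
  + by move=> p; apply: XA.
  + exact: LP.
- have dQ := tdirectedW dsub_tdirected.
  have := @colim_bigcup Y L LP LY dsub_poset dQ id (fun _ _ u => u) setT x _ k _ TU.
  have cov p : setT p -> exists S : dsub, S p.
    move=> _; have [|S Sp] := @dsub_cover unit (fun _ => p).
      by exists (fun _ => Root) => -[] [].
    by exists S; apply: (Sp tt).
  move=> /(_ cov) []; first by move=> S p Sp Up; apply: kP.
    by [].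
  move=> kc ku; split=> [p q u|y m mc]; first exact: (kc p q u).
  exact: ku.
- move=> s sm; have [S SU] := dsub_chain sm.
  have u n : @ple dsub_poset (s n) S by rewrite /= SU => p np; exists n.
  exists S, u; apply: (@colim_bigcup Y L LP LY natP natP_directed s sm S _ (L S)).
  + by rewrite SU => p [n _ np]; exists n.
  + exact: LP.
  + by move=> n p np Sp; rewrite LY (Prop_irrelevance (u n p np) Sp).
  + exact: u.
Qed.

End Resolution.

(** * Creation of colimits, accessibility and products *)

Section Creation.
Variables (C D : Cat) (F : Functor C D).

(** Colimits are unique up to isomorphism, so preservation of one colimit of a diagram gives
    preservation of every other. *)
Lemma colim_transfer (P : Poset) (X : Functor (poset_cat P) C) x z
    (l : forall p : carrier P, Hom (X p) x) (k : forall p : carrier P, Hom (X p) z) :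
  colim l -> colim k -> colim (X := fcompose F X) (fun p => fmap F (k p)) ->
  colim (X := fcompose F X) (fun p => fmap F (l p)).
Proof.
move=> Xx Xz FXz.
have [a aP] := colim_desc Xx (colim_compat Xz).
have [b bP] := colim_desc Xz (colim_compat Xx).
have ba : b \oc a = idc x.
  by apply: (colim_ext Xx) => p; rewrite -ccompA aP bP ccomp_id_l.
apply: colimI => /=.
- by move=> p q u; rewrite -fmap_comp (colim_compat Xx).
- move=> y m mc; have [h hP] := colim_desc FXz mc.
  by exists (h \oc fmap F a) => p; rewrite -ccompA -fmap_comp aP hP.
- move=> y h h' hh'.
  suff e : h \oc fmap F b = h' \oc fmap F b.
    have := congr1 (fun k => k \oc fmap F a) e.
    by rewrite -!ccompA -!fmap_comp ba fmap_id !ccomp_id_r.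
  by apply: (colim_ext FXz) => p; rewrite /= -!ccompA -!fmap_comp bP hh'.
Qed.

Lemma creation :
  (forall (P : Poset) (X : Functor (poset_cat P) C), directed P ->
    exists z (k : forall p : carrier P, Hom (X p) z),
      colim k /\ colim (X := fcompose F X) (fun p => fmap F (k p))) ->
  has_directed_colimits C /\ preserves F.
Proof.
move=> cr; split=> [P dP X|P X x l dP Xx]; have [z [k [Xz FXz]]] := cr P X dP.
  exact: (ex_intro _ _ (colim_is_colimit Xz)).
exact: colim_transfer Xx Xz FXz.
Qed.

End Creation.

(** * Cofinality and criteria for accessibility *)

Lemma colim_cofinal (T Q : Poset) (C : Cat) (Y : Functor (poset_cat T) C) x
    (l : forall t : carrier T, Hom (Y t) x) (s : carrier Q -> carrier T)
    (sm : forall i j, ple i j -> ple (s i) (s j)) :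
  directed Q -> (forall t, exists q, ple t (s q)) -> colim l ->
  colim (X := fcompose Y (mono_functor sm)) (fun q => l (s q)).
Proof.
move=> [_ dir] /dep_choice[c cP] Yx; apply: colimI => /=.
- by move=> p q u; rewrite (colim_compat Yx).
- move=> y m mc.
  have mP q q' t (u : ple t (s q)) (v : ple t (s q')) :
      m q \oc fmap Y u = m q' \oc fmap Y v.
    have [r [qr q'r]] := dir q q'.
    rewrite -(mc _ _ qr) -(mc _ _ q'r) -!ccompA.
    by rewrite !(fmapK Y _ _ (ple_trans u (sm _ _ qr))).
  have [|h hP] := colim_desc Yx (m := fun t => m (c t) \oc fmap Y (cP t)).
    move=> t t' u; rewrite -ccompA (fmapK Y _ _ (ple_trans u (cP t'))).
    exact: mP.
  exists h => q; rewrite hP (mP _ q _ _ (ple_refl _)) fmap1; exact: ccomp_id_r.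
- move=> y h h' hh'; apply: (colim_ext Yx) => t.
  by rewrite -(colim_compat Yx (cP t)) !ccompA hh'.
Qed.

(** The index of accessibility is the successor [M] of [tree Z], and [tdirectedE] identifies
    [M]-directed posets with the [tdirected Z] ones. *)
Lemma accessible_intro (Z : small) (C : Cat) (J : small) (A : J -> C) :
  has_directed_colimits C -> (forall j, pres Z (A j)) ->
  (forall x, exists (Q : Poset) (Y : Functor (poset_cat Q) C)
      (k : forall q : carrier Q, Hom (Y q) x),
    [/\ tdirected Z Q, forall q : carrier Q, exists j, isomorphic (Y q) (A j)
      & colim k]) ->
  accessible C.
Proof.
move=> hC AP cov; have [M Mreg ltM] := succ_cardinal Z.
have dM P := tdirectedE P ltM.
exists M; split=> //; split; first by move=> P /dM/tdirectedW; apply: hC.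
exists J, A; split=> [j|x]; first by apply: pres_presentable (AP j) => P /dM.
have [Q [Y [k [dQ YA Yx]]]] := cov x.
exists Q, Y, (MkCocone (Yx.1 : forall i j (u : @Hom (poset_cat Q) i j), _)).
by split=> //; [apply/dM|apply: colim_is_colimit].
Qed.

(** Directed colimits allow the index to be raised to any [Z] that accommodates [lambda], so one [Z]
    can serve several categories at once. *)
Lemma accessible_gen (C : Cat) : accessible C -> has_directed_colimits C ->
  exists (lambda J : small) (A : J -> C), forall Z, embeds lambda (tree Z) ->
  (forall j, pres Z (A j)) /\
  forall x, exists (Q : Poset) (Y : Functor (poset_cat Q) C)
      (k : forall q : carrier Q, Hom (Y q) x),
    [/\ tdirected Z Q, forall q : carrier Q, gen Z A (Y q), colim k
      & chain_continuous Y].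
Proof.
move=> [lambda [[linf _] [_ [J [A [AP cov]]]]]] hC.
exists lambda, J, A => Z lZ; split=> [j|x]; first exact: presentable_pres (AP j).
have [P [X [c [dP XA /is_colimitE Xx <-]]]] := cov x.
exact: (resolution Z (lambda_directedW linf dP) hC XA Xx).
Qed.

(** Every object is a colimit of presentables, hence presentable once [Z] is large enough for
    [lambda] and for the shape of the diagram. *)
Lemma accessible_pres (C : Cat) : accessible C -> forall x : C,
  exists kappa : small, forall Z, embeds kappa (tree Z) -> pres Z x.
Proof.
move=> [lambda [[linf _] [_ [J [A [AP cov]]]]]] x.
have [P [X [c [dP XA /is_colimitE Xx <-]]]] := cov x.
exists (lambda + carrier P)%type => Z kZ.
have lZ : embeds lambda (tree Z).
  by apply: embeds_trans kZ; exists inl => a b [].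
have PZ : embeds (carrier P) (tree Z).
  by apply: embeds_trans kZ; exists inr => a b [].
apply: (@gen_pres _ _ _ A); first by move=> j; apply: presentable_pres (AP j).
by exists P, X, (leg c); split=> //; apply: lambda_directedW dP.
Qed.

(** * Products of categories, resolved by products of posets *)

Definition prod_poset (I : small) (Q : I -> Poset) : Poset.
Proof.
refine (@MkPoset (forall i, carrier (Q i)) (fun p q => forall i, ple (p i) (q i))
  (fun p i => ple_refl (p i)) (fun q p r pq qr i => ple_trans (pq i) (qr i)) _).
move=> p q pq qp; apply: functional_extensionality_dep => i.
exact: ple_anti (pq i) (qp i).
Defined.

Lemma prod_tdirected (Z I : small) (Q : I -> Poset) :
  (forall i, tdirected Z (Q i)) -> tdirected Z (prod_poset Q).
Proof.
move=> dQ A e AZ; have /dep_choice[u uP] := fun i => dQ i A (fun a => e a i) AZ.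
by exists u => a i; apply: uP.
Qed.

Definition prod_functor (I : small) (Q : I -> Poset) (K : I -> Cat)
    (Y : forall i, Functor (poset_cat (Q i)) (K i)) :
  Functor (poset_cat (prod_poset Q)) (prod_cat K).
Proof.
refine (@MkFunctor (poset_cat (prod_poset Q)) (prod_cat K)
  (fun q i => Y i (q i)) (fun p q u i => fmap (Y i) (u i)) _ _).
- by move=> q; apply: functional_extensionality_dep => i; apply: fmap1.
- move=> p q r v u; apply: functional_extensionality_dep => i.
  by apply/esym; apply: fmapK.
Defined.

Lemma prod_isomorphic (I : small) (K : I -> Cat) (x y : prod_cat K) :
  (forall i, isomorphic (x i) (y i)) -> isomorphic x y.
Proof.
move=> /dep_choice[f] /dep_choice[g fg]; exists f, g.
by split; apply: functional_extensionality_dep => i; have [] := fg i.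
Qed.

Section Product.
Variables (I : small) (K : I -> Cat).

Lemma colim_prod (P : Poset) (X : Functor (poset_cat P) (prod_cat K))
    (x : prod_cat K) (l : forall p : carrier P, Hom (X p) x) :
  (forall i, colim (X := fcompose (prod_proj K i) X) (fun p => l p i)) -> colim l.
Proof.
move=> Xx; apply: colimI.
- move=> p q u; apply: functional_extensionality_dep => i.
  exact: (colim_compat (Xx i)).
- move=> y m mc.
  have /dep_choice[h hP] : forall i, exists h : Hom (x i) (y i),
      forall p, h \oc l p i = m p i.
    move=> i; apply: (colim_desc (Xx i)) => p q u.
    exact: (congr1 (fun f => f i) (mc p q u)).
  by exists h => p; apply: functional_extensionality_dep => i; apply: hP.
- move=> y h k hk; apply: functional_extensionality_dep => i.
  by apply: (colim_ext (Xx i)) => p; apply: (congr1 (fun f => f i) (hk p)).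
Qed.

Hypotheses (accK : forall i, accessible (K i))
  (hK : forall i, has_directed_colimits (K i)).

Lemma prod_creation (P : Poset) (X : Functor (poset_cat P) (prod_cat K)) :
  directed P -> exists z (k : forall p : carrier P, Hom (X p) z), colim k /\
    forall i, colim (X := fcompose (prod_proj K i) X)
      (fun p => fmap (prod_proj K i) (k p)).
Proof.
move=> dP.
have /dep_choice[z] := fun i =>
  has_directed_colim (@hK i) (fcompose (prod_proj K i) X) dP.
move=> /dep_choice[k kP].
by exists z, (fun p i => k i p); split=> //; apply: colim_prod.
Qed.

Lemma prod_has_directed_colimits : has_directed_colimits (prod_cat K).
Proof.
move=> P dP X; have [z [k [Xz _]]] := prod_creation X dP.
exact: (ex_intro _ _ (colim_is_colimit Xz)).
Qed.

Lemma prod_proj_preserves i : preserves (prod_proj K i).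
Proof.
move=> P X x l dP Xx; have [z [k [Xz KXz]]] := prod_creation X dP.
exact: colim_transfer Xx Xz (KXz i).
Qed.

(** The stages found in the separate coordinates form a family indexed by [I], which has a common
    bound. *)
Lemma prod_pres (Z : small) (x : prod_cat K) : embeds I (tree Z) ->
  (forall i, pres Z (x i)) -> pres Z x.
Proof.
move=> IZ xP P X y l dP Xy.
have Xyi i := prod_proj_preserves i (tdirectedW dP) Xy.
split=> [f|p g g' gg'].
  have /dep_choice[s sP] i : exists s : {p : carrier P & Hom (x i) (X p i)},
      l _ i \oc projT2 s = f i.
    have [fac _] := xP i _ _ _ _ dP (Xyi i).
    by have [p [g gf]] := fac (f i); exists (existT _ p g).
  have [p pP] := dP _ (fun i => projT1 (s i)) IZ.
  exists p, (fun i => fmap X (pP i) i \oc projT2 (s i)).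
  apply: functional_extensionality_dep => i /=; rewrite -sP ccompA.
  by congr (_ \oc _); apply: (colim_compat (Xyi i)).
have /dep_choice[r rP] i : exists q, exists w : ple p q,
    fmap X w i \oc g i = fmap X w i \oc g' i.
  have [_ inj] := xP i _ _ _ _ dP (Xyi i).
  have [|q [w wP]] := inj p (g i) (g' i); first exact: (congr1 (fun f => f i) gg').
  by exists q, w.
have [q [pq qP]] := tdirected_bound p r dP IZ.
exists q, pq; apply: functional_extensionality_dep => i /=.
have [w e] := rP i.
have e' := congr1 (fun f => f i) (fmapK X w (qP i) pq).
by rewrite -[fmap X pq i]e' /= -!ccompA e.
Qed.

Lemma prod_accessible : accessible (prod_cat K).
Proof.
have /dep_choice[lambda] := fun i => accessible_gen (accK i) (@hK i).
move=> /dep_choice[J0] /dep_choice[A0 AP].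
(* Large enough to bound families indexed by [I] and to contain every [lambda i]. *)
pose Z : small := (I + {i : I & lambda i})%type.
have IZ : embeds I (tree Z) by apply: embeds_atom; exists inl => a b [].
have lZ i : embeds (lambda i) (tree Z).
  apply: embeds_atom; exists (fun a => inr (existT _ i a)) => a b [].
  exact: existT_inj.
have /dep_choice[J] := fun i => gen_small Z (A0 i).
move=> /dep_choice[B BP].
apply: (@accessible_intro Z (prod_cat K) (forall i, J i) (fun j i => B i (j i))).
- exact: prod_has_directed_colimits.
- move=> j; apply: prod_pres => // i.
  by apply: gen_pres ((BP i).1 _); apply: (AP i Z (lZ i)).1.
- move=> x.
  have /dep_choice[Q] := fun i => (AP i Z (lZ i)).2 (x i).
  move=> /dep_choice[Y] /dep_choice[k kP].
  have dQ i : tdirected Z (Q i) by have [] := kP i.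
  exists (prod_poset Q), (prod_functor Y), (fun q i => k i (q i)).
  have dPQ := prod_tdirected dQ; split=> // [q|].
    have /dep_choice[j jP] i : exists j, isomorphic (Y i (q i)) (B i j).
      by have [_ gY _ _] := kP i; apply: (BP i).2.
    by exists j; apply: prod_isomorphic.
  apply: colim_prod => i; have [_ _ Yx _] := kP i.
  apply: (colim_cofinal (s := fun q : carrier (prod_poset Q) => q i)
    (fun p q pq => pq i) (tdirectedW dPQ) _ Yx) => t.
  (* For cofinality of the projection to [Q i], [t] is extended to a tuple by arbitrary values off
     [i]; [eq_rect] types the condition at [j = i]. *)
  have /dep_choice[q qP] j : exists q : carrier (Q j),
      forall e : i = j, ple (eq_rect i (fun j => carrier (Q j)) t j e) q.
    have [[q0] _] := tdirectedW (dQ j).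
    case: (pselect (i = j)) => [e|ne]; last by exists q0.
    by subst j; exists t => e; rewrite (Prop_irrelevance e erefl); apply: ple_refl.
  by exists q; apply: (qP i erefl).
Qed.


End Product.

(** * Equifiers *)

(** A single [Z] both resolves [K] and makes the images of the generators presentable: [F] carries
    generated objects to objects generated by the [F (A j)], and [Z] contains a presentability bound
    for each of these. *)
Lemma functor_resolution (K L : Cat) (F : Functor K L) :
  accessible K -> has_directed_colimits K -> accessible L -> preserves F ->
  exists (Z J : small) (B : J -> K),
  [/\ forall j, pres Z (B j), forall j, pres Z (F (B j)) &
  forall x, exists (T : Poset) (Y : Functor (poset_cat T) K)
      (k : forall t : carrier T, Hom (Y t) x),
    [/\ tdirected Z T, forall t : carrier T, exists j, isomorphic (Y t) (B j),
      colim k & chain_continuous Y]].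
Proof.
move=> accK hK accL FP; have [lambda [J0 [A AP]]] := accessible_gen accK hK.
have /choice[kappa kP] := fun j => accessible_pres accL (F (A j)).
pose Z : small := (lambda + {j : J0 & kappa j})%type.
have lZ : embeds lambda (tree Z) by apply: embeds_atom; exists inl => a b [].
have kZ j : embeds (kappa j) (tree Z).
  apply: embeds_atom; exists (fun a => inr (existT _ j a)) => a b [].
  exact: existT_inj.
have [J [B [gB BP]]] := gen_small Z A; have [AZ res] := AP Z lZ.
exists Z, J, B; split=> [j|j|x].
- exact: gen_pres AZ (gB j).
- by apply: gen_pres (gen_fmap FP (gB j)) => j'; apply: kP.
- have [T [Y [k [dT gY Yx cY]]]] := res x.
  by exists T, Y, k; split=> // t; apply: BP.
Qed.

Lemma natP_mono (T : Poset) (s : nat -> carrier T) :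
  (forall n, ple (s n) (s n.+1)) ->
  forall i j : carrier natP, ple i j -> ple (s i) (s j).
Proof.
by apply: homo_leq => [t|t1 t2 t3]; [apply: ple_refl|apply: ple_trans].
Qed.

Section Equifier.
Variables (K L : Cat) (F G : Functor K L) (phi psi : NatTrans F G).
Hypotheses (FP : preserves F) (GP : preserves G).
Notation E := (equifier phi psi).

Lemma colim_equifier (P : Poset) (X : Functor (poset_cat P) E) (x : E)
    (l : forall p : carrier P, Hom (X p) x) :
  colim (X := fcompose (eq_incl phi psi) X)
    (fun p => fmap (eq_incl phi psi) (l p)) -> colim l.
Proof.
move=> Xx; apply: colimI.
- exact: (colim_compat Xx).
- by move=> y m mc; apply: (colim_desc Xx).
- by move=> y h k hk; apply: (colim_ext Xx).
Qed.

(** [F] preserves the colimit [z], and [phi z] and [psi z] agree on every leg by naturality; so [z]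
    lies in the equifier. *)
Lemma equifier_creation : has_directed_colimits K ->
  has_directed_colimits E /\ preserves (eq_incl phi psi).
Proof.
move=> hK; apply: creation => P X dP.
have [z [k kP]] := has_directed_colim hK (fcompose (eq_incl phi psi) X) dP.
have e : phi z = psi z.
  apply: (colim_ext (FP dP kP)) => p.
  rewrite /= !naturality; congr (_ \oc _); exact: (svalP (X p)).
exists (exist _ z e), k; split=> //.
exact: (@colim_equifier P X (exist _ z e) k).
Qed.

Lemma equifier_pres (Z : small) (x : E) : has_directed_colimits K ->
  pres Z (sval x) -> pres Z x.
Proof.
move=> hK xP P X y l dP Xy; have [_ iP] := equifier_creation hK.
exact: (xP _ _ _ _ dP (iP _ _ _ _ (tdirectedW dP) Xy)).
Qed.

Lemma equified_iso x y : isomorphic x y -> phi x = psi x -> phi y = psi y.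
Proof.
move=> [f [g [_ fg]]] e.
rewrite -[phi y]ccomp_id_r -[psi y]ccomp_id_r -!fmap_id -fg !fmap_comp !ccompA.
by rewrite !naturality e.
Qed.

Lemma equifier_accessible : accessible K -> has_directed_colimits K ->
  accessible L -> accessible E.
Proof.
move=> accK hK accL.
have [Z [J [B [BZ FBZ res]]]] := functor_resolution accK hK accL FP.
apply: (@accessible_intro Z E {j | phi (B j) = psi (B j)}
  (fun j => exist _ (B (sval j)) (svalP j))).
- exact: (equifier_creation hK).1.
- by move=> j; apply: equifier_pres => /=; try exact: BZ.
move=> [x xe]; have [T [Y [k [dT YB Yx cY]]]] := res x.
have FYZ t : pres Z (F (Y t)).
  have [j /isomorphic_sym jt] := YB t.
  exact: pres_iso (isomorphic_fmap F jt) (FBZ j).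
pose good t := phi (Y t) = psi (Y t).
have GYx := GP (tdirectedW dT) Yx.
(* [phi (Y t)] and [psi (Y t)] agree after mapping to [G x], because [x] is equified; presentability
   of [F (Y t)] makes them agree at some later [t']. *)
have /dep_choice[next nP] t : exists t', exists u : ple t t',
    fmap G (fmap Y u) \oc phi (Y t) = fmap G (fmap Y u) \oc psi (Y t).
  have [_ inj] := FYZ t _ _ _ _ dT GYx.
  by have [|t' [u uP]] := inj t (phi (Y t)) (psi (Y t));
    [rewrite /= -!naturality xe|exists t', u].
(* At the colimit of the iterates of [next], the two components agree on each leg, since the leg at
   [s n] passes through [s n.+1]. *)
have above t0 : exists2 t, ple t0 t & good t.
  pose s n := iter n next t0.
  have sn n : ple (s n) (s n.+1) by have [u _] := nP (s n).
  have [t [u tP]] := cY s (natP_mono sn).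
  exists t; first exact: (u 0).
  apply: (colim_ext (FP natP_directed tP)) => n /=.
  have [v e] := nP (s n).
  by rewrite !naturality -(fmapK Y v (u n.+1)) fmap_comp -!ccompA e.
have dQ : tdirected Z (sub_poset good).
  move=> A e AZ; have [t0 t0P] := dT A (fun a => sval (e a)) AZ.
  have [t t0t gt] := above t0.
  by exists (exist _ t gt) => a; apply: ple_trans t0t.
pose YE : Functor (poset_cat (sub_poset good)) E :=
  @MkFunctor (poset_cat (sub_poset good)) E (fun q => exist _ (Y (sval q)) (svalP q))
    (fun p q u => fmap (restr Y good) u) (fmap_id (restr Y good))
    (@fmap_comp _ _ (restr Y good)).
exists (sub_poset good), YE, (fun q => k (sval q)); split=> //.
- move=> [t gt]; have [j tj] := YB t.
  exists (exist _ j (equified_iso tj gt)).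
  by have [f [g fg]] := tj; exists f, g.
- apply: colim_equifier.
  apply: (colim_cofinal (s := sval : carrier (sub_poset good) -> _)
    (fun p q u => u) (tdirectedW dQ) _ Yx) => t.
  by have [t' tt' gt'] := above t; exists (exist _ t' gt').
Qed.

End Equifier.

(** * Inserters *)

Section Inserter.
Variables (K L : Cat) (F G : Functor K L).
Hypotheses (FP : preserves F) (GP : preserves G).
Notation I := (inserter F G).

(** The map induced in [K] is a morphism of the inserter because its square can be tested on the
    legs of [F x], again a colimit. *)
Lemma colim_inserter (P : Poset) (X : Functor (poset_cat P) I) (x : I)
    (l : forall p : carrier P, Hom (X p) x) :
  directed P ->
  colim (X := fcompose (ins_proj F G) X) (fun p => fmap (ins_proj F G) (l p)) ->
  colim l.
Proof.
move=> dP Xx; apply: colimI.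
- by move=> p q u; apply: ins_hom_eq; apply: (colim_compat Xx).
- move=> y m mc.
  have [|h hP] := colim_desc Xx (m := fun p => sval (m p)).
    by move=> p q u; apply: (congr1 sval (mc p q u)).
  have hI : projT2 y \oc fmap F h = fmap G h \oc projT2 x.
    apply: (colim_ext (FP dP Xx)) => p /=.
    rewrite -!ccompA (svalP (l p)) -fmap_comp hP (svalP (m p)) ccompA.
    by rewrite -fmap_comp hP.
  by exists (exist _ h hI) => p; apply: ins_hom_eq; apply: hP.
- move=> y h k hk; apply: ins_hom_eq; apply: (colim_ext Xx) => p.
  exact: (congr1 sval (hk p)).
Qed.

Lemma inserter_creation : has_directed_colimits K ->
  has_directed_colimits I /\ preserves (ins_proj F G).
Proof.
move=> hK; apply: creation => P X dP.
have [z [k kP]] := has_directed_colim hK (fcompose (ins_proj F G) X) dP.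
have [|f fP] := colim_desc (FP dP kP)
    (m := fun p => fmap G (k p) \oc projT2 (X p)).
  move=> p q u /=; rewrite -ccompA (svalP (fmap X u)) ccompA -fmap_comp.
  by rewrite (colim_compat kP).
exists (existT _ z f), (fun p => exist _ (k p) (fP p)); split=> //.
exact: (@colim_inserter P X (existT _ z f) (fun p => exist _ (k p) (fP p))).
Qed.

(** A factorization in [K] satisfies the inserter square only after mapping to the colimit;
    presentability of the image under [F] makes it commute at a later stage. *)
Lemma inserter_pres (Z : small) (x : I) : has_directed_colimits K ->
  pres Z (projT1 x) -> pres Z (F (projT1 x)) -> pres Z x.
Proof.
move=> hK xP FxP P X y l dP Xy; have [_ iP] := inserter_creation hK.
have Xy' := iP _ _ _ _ (tdirectedW dP) Xy.
have [xf xi] := xP _ _ _ _ dP Xy'; split=> [f|p g g' gg'].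
  have [p [g gf]] := xf (sval f).
  have [_ inj] := FxP _ _ _ _ dP (GP (tdirectedW dP) Xy').
  have [|q [u uP]] := inj p (projT2 (X p) \oc fmap F g) (fmap G g \oc projT2 x).
    rewrite /= !ccompA -(svalP (l p)) -ccompA -!fmap_comp gf.
    exact: (svalP f).
  have gI : projT2 (X q) \oc fmap F (sval (fmap X u) \oc g) =
      fmap G (sval (fmap X u) \oc g) \oc projT2 x.
    by rewrite !fmap_comp ccompA (svalP (fmap X u)) -!ccompA.
  exists q, (exist _ (sval (fmap X u) \oc g) gI : @Hom I x (X q)).
  apply: ins_hom_eq; rewrite /= -gf ccompA.
  by congr (_ \oc _); apply: (colim_compat Xy').
have [|q [u uP]] := xi p (sval g) (sval g'); first exact: (congr1 sval gg').
by exists q, u; apply: ins_hom_eq.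
Qed.

(** * Approximate and exact partial solutions for a fixed map from [F x] to [G x] *)

Section Stages.
Variables (Z : small) (T : Poset) (Y : Functor (poset_cat T) K) (x : K).
Variables (k : forall t : carrier T, Hom (Y t) x) (f : Hom (F x) (G x)).
Hypotheses (dT : tdirected Z T) (Yx : colim k) (cY : chain_continuous Y).
Hypothesis FYZ : forall t : carrier T, pres Z (F (Y t)).
Arguments k : clear implicits.

(* An approximation of [f] at [src] that is only defined up to [tgt]. *)
Record stage : small := Stage {
  src : carrier T;
  tgt : carrier T;
  act : Hom (F (Y src)) (G (Y tgt));
  act_ok : fmap G (k tgt) \oc act = f \oc fmap F (k src) }.

Definition stage_le (a b : stage) : Prop :=
  exists (u : ple (src a) (src b)) (v : ple (tgt a) (tgt b)),
    act b \oc fmap F (fmap Y u) = fmap G (fmap Y v) \oc act a.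

Lemma stage_le_refl a : stage_le a a.
Proof.
exists (ple_refl _), (ple_refl _).
by rewrite !fmap1 !fmap_id ccomp_id_l ccomp_id_r.
Qed.

Lemma stage_le_trans b a c : stage_le a b -> stage_le b c -> stage_le a c.
Proof.
move=> [u [v uv]] [u' [v' uv']]; exists (ple_trans u u'), (ple_trans v v').
rewrite -(fmapK Y u u') -(fmapK Y v v') !fmap_comp !ccompA uv'.
by rewrite -!ccompA uv.
Qed.

Let GYx : colim (X := fcompose G Y) (fun t => fmap G (k t)) := GP (tdirectedW dT) Yx.

Lemma stage_exists t : exists a, src a = t.
Proof.
have [fac _] := @FYZ t _ _ _ _ dT GYx.
have [t' [g gP]] := fac (f \oc fmap F (k t)).
by exists (Stage gP).
Qed.

(** The source of [b] is put above all given sources and targets. The comparison squares commute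
    after mapping to [G x], so presentability lets a larger target make them commute. Sources above
    earlier targets will make the two interleave along a chain. *)
Lemma stage_above (A : small) (a : A -> stage) t0 : embeds A (tree Z) ->
  exists b, ple t0 (src b) /\
    forall i, stage_le (a i) b /\ ple (tgt (a i)) (src b).
Proof.
move=> AZ.
have [s1 [t0s1 s1P]] := tdirected_bound t0 (fun i => src (a i)) dT AZ.
have [s2 [s1s2 s2P]] := tdirected_bound s1 (fun i => tgt (a i)) dT AZ.
have [b bs] := stage_exists s2; subst s2.
have sb i : ple (src (a i)) (src b) := ple_trans (s1P i) s1s2.
have [t1 [bt1 t1P]] := tdirected_bound (tgt b) (fun i => tgt (a i)) dT AZ.
have /dep_choice[r rP] i : exists r, exists w : ple t1 r,
    fmap G (fmap Y w) \oc (fmap G (fmap Y bt1) \oc (act b \oc fmap F (fmap Y (sb i)))) =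
    fmap G (fmap Y w) \oc (fmap G (fmap Y (t1P i)) \oc act (a i)).
  have [_ inj] := @FYZ (src (a i)) _ _ _ _ dT GYx.
  have [|r [w wP]] := inj t1
      (fmap G (fmap Y bt1) \oc (act b \oc fmap F (fmap Y (sb i))))
      (fmap G (fmap Y (t1P i)) \oc act (a i)); last by exists r, w.
  rewrite /= !ccompA -!fmap_comp !(colim_compat Yx) !act_ok -ccompA -fmap_comp.
  by rewrite (colim_compat Yx).
have [t2 [t12 t2P]] := tdirected_bound t1 r dT AZ.
have ok : fmap G (k t2) \oc (fmap G (fmap Y (ple_trans bt1 t12)) \oc act b) =
    f \oc fmap F (k (src b)).
  by rewrite ccompA -fmap_comp (colim_compat Yx) act_ok.
exists (Stage ok); split=> [|i]; first exact: ple_trans s1s2.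
split; last exact: s2P.
exists (sb i), (ple_trans (t1P i) t12) => /=.
have [w wP] := rP i.
rewrite -(fmapK Y bt1 t12) -(fmapK Y (t1P i) t12) -(fmapK Y w (t2P i)).
by rewrite !fmap_comp -!ccompA wP.
Qed.

(** A stage with equal source and target: an object of the inserter over [Y cobj], with a map to the
    object given by [f]. *)
Record coalg : small := Coalg {
  cobj : carrier T;
  cact : Hom (F (Y cobj)) (G (Y cobj));
  cact_ok : fmap G (k cobj) \oc cact = f \oc fmap F (k cobj) }.

Definition coalg_stage (a : coalg) : stage := Stage (cact_ok a).

(** An omega-chain of stages starts above the given data. The value at a suitable bound [t] is the
    colimit over the sources, so the actions induce a map from [F (Y t)] to [G (Y t)]. *)
Lemma coalg_above (A : small) (a : A -> coalg) t0 : embeds A (tree Z) ->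
  exists b, ple t0 (cobj b) /\
    forall i, stage_le (coalg_stage (a i)) (coalg_stage b).
Proof.
move=> AZ.
have [b0 [tb0 ab0]] := stage_above (fun i => coalg_stage (a i)) t0 AZ.
have /choice[next nP] b : exists c, stage_le b c /\ ple (tgt b) (src c).
  have [|c [_ bc]] := @stage_above unit (fun _ => b) t0; last by exists c; apply: bc tt.
  by exists (fun _ => Root) => -[] [].
pose b n := iter n next b0.
have bm : {homo b : i j / i <= j >-> stage_le i j}.
  apply: homo_leq; [exact: stage_le_refl|exact: stage_le_trans|].
  by move=> n; have [] := nP (b n).
have sm (i j : carrier natP) : ple i j -> ple (src (b i)) (src (b j)).
  by move=> /bm[].
have [t [u tP]] := cY sm.
(* The target of [b n] lies below the source of the next stage, hence below [t]. *)
have v n : ple (tgt (b n)) t.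
  by apply: ple_trans (u n.+1); have [] := nP (b n).
have [|g gP] := colim_desc (FP natP_directed tP)
    (m := fun n => fmap G (fmap Y (v n)) \oc act (b n)).
  move=> i j ij /=; have [w [w' ww']] := bm i j ij.
  rewrite -ccompA (Prop_irrelevance (sm i j ij) w) ww' ccompA -fmap_comp.
  by rewrite (fmapK Y w' (v j) (v i)).
have gok : fmap G (k t) \oc g = f \oc fmap F (k t).
  apply: (colim_ext (FP natP_directed tP)) => n /=.
  have := gP n => /= gn.
  rewrite -ccompA gn ccompA -fmap_comp (colim_compat Yx) act_ok.
  by rewrite -ccompA -fmap_comp (colim_compat Yx).
exists (Coalg gok); split=> /=; first exact: ple_trans (u 0).
move=> i; apply: stage_le_trans (ab0 i).1 _.
by exists (u 0), (v 0); apply: (gP 0).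
Qed.

Definition coalg_poset : Poset.
Proof.
refine (@MkPoset coalg (fun a b => stage_le (coalg_stage a) (coalg_stage b))
  (fun a => stage_le_refl _)
  (fun b a c => @stage_le_trans (coalg_stage b) (coalg_stage a) (coalg_stage c)) _).
move=> [s a ak] [t b bk] [/= u [v uv]] [/= w _].
have st := ple_anti u w; subst t.
(* Over a single object the transition maps are identities, so the square forces the two actions to
   coincide. *)
rewrite !fmap1 !fmap_id ccomp_id_l ccomp_id_r in uv; subst b.
by rewrite (Prop_irrelevance ak bk).
Defined.

Lemma coalg_tdirected : tdirected Z coalg_poset.
Proof.
move=> A a AZ; have [[t0] _] := tdirectedW dT.
by have [b [_ bP]] := coalg_above a t0 AZ; exists b.
Qed.

Lemma coalg_cofinal t : exists a, ple t (cobj a).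
Proof.
have [|a [ta _]] := @coalg_above False (fun e => match e with end) t.
  by exists (fun e : False => match e with end) => -[].
by exists a.
Qed.

Lemma coalg_mono (a b : carrier coalg_poset) : ple a b -> ple (cobj a) (cobj b).
Proof. by move=> [u]. Qed.

(** The source and target inequalities in [stage_le] are here proofs of one proposition, hence
    equal. *)
Lemma coalg_square (a b : carrier coalg_poset) (u : ple a b) :
  cact b \oc fmap F (fmap Y (coalg_mono u)) =
  fmap G (fmap Y (coalg_mono u)) \oc cact a.
Proof.
have [v [w vw]] := u.
by rewrite (Prop_irrelevance (coalg_mono u) v) vw (Prop_irrelevance w v).
Qed.

Definition coalg_functor : Functor (poset_cat coalg_poset) I.
Proof.
refine (@MkFunctor (poset_cat coalg_poset) I
  (fun a => existT (fun x => Hom (F x) (G x)) (Y (cobj a)) (cact a))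
  (fun a b u => exist _ (fmap Y (coalg_mono u)) (coalg_square u)) _ _).
- by move=> a; apply: ins_hom_eq; apply: fmap1.
- by move=> a b c v u; apply: ins_hom_eq; apply/esym; apply: fmapK.
Defined.

Lemma coalg_colim : colim (X := coalg_functor) (x := existT _ x f : I)
  (fun a => exist _ (k (cobj a)) (esym (cact_ok a))).
Proof.
apply: colim_inserter; first exact: tdirectedW coalg_tdirected.
exact: (colim_cofinal coalg_mono (tdirectedW coalg_tdirected) coalg_cofinal Yx).
Qed.

End Stages.

Lemma inserter_accessible : accessible K -> has_directed_colimits K ->
  accessible L -> accessible I.
Proof.
move=> accK hK accL.
have [Z [J [B [BZ FBZ res]]]] := functor_resolution accK hK accL FP.
apply: (@accessible_intro Z I {j & Hom (F (B j)) (G (B j))}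
  (fun j => existT _ (B (projT1 j)) (projT2 j))).
- exact: (inserter_creation hK).1.
- by move=> j; apply: (inserter_pres hK); [apply: BZ|apply: FBZ].
move=> [x f]; have [T [Y [k [dT YB Yx cY]]]] := res x.
have FYZ (t : carrier T) : pres Z (F (Y t)).
  have [j /isomorphic_sym jt] := YB t.
  exact: pres_iso (isomorphic_fmap F jt) (FBZ j).
exists (coalg_poset k f), (coalg_functor k f),
  (fun a => exist _ (k (cobj a)) (esym (cact_ok a))); split.
- exact: coalg_tdirected.
- move=> a; have [j [g [h [hg gh]]]] := YB (cobj a).
  (* The structure map is transported to the isomorphic generator [B j] by conjugation. *)
  exists (existT _ j (fmap G g \oc cact a \oc fmap F h)).
  have gI : fmap G g \oc cact a \oc fmap F h \oc fmap F g = fmap G g \oc cact a.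
    by rewrite -ccompA -fmap_comp hg fmap_id ccomp_id_r.
  have hI : cact a \oc fmap F h =
      fmap G h \oc (fmap G g \oc cact a \oc fmap F h).
    by rewrite !ccompA -fmap_comp hg fmap_id ccomp_id_l.
  by exists (exist _ g gI), (exist _ h hI); split; apply: ins_hom_eq.
- exact: (coalg_colim f dT Yx cY FYZ).
Qed.

End Inserter.

Theorem theorem2p2 :
  (forall (I : small) (K : I -> Cat),
     (forall i, accessible (K i)) ->
     (forall i, has_directed_colimits (K i)) ->
     accessible (prod_cat K) /\
     has_directed_colimits (prod_cat K) /\
     (forall i, preserves_directed_colimits (prod_proj K i)) /\
     (forall (L : Cat), accessible L -> has_directed_colimits L ->
      forall Q : forall i, Functor L (K i),
        (forall i, preserves_directed_colimits (Q i)) ->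
        preserves_directed_colimits (prod_lift Q)))
  /\
  (forall (K L : Cat),
     accessible K -> has_directed_colimits K ->
     accessible L -> has_directed_colimits L ->
   forall F G : Functor K L,
     preserves_directed_colimits F -> preserves_directed_colimits G ->
     accessible (inserter F G) /\
     has_directed_colimits (inserter F G) /\
     preserves_directed_colimits (ins_proj F G) /\
     (forall (B : Cat), accessible B -> has_directed_colimits B ->
      forall H : Functor B K, preserves_directed_colimits H ->
      forall psi : NatTrans (fcompose F H) (fcompose G H),
        preserves_directed_colimits (ins_lift psi)))
  /\
  (forall (K L : Cat),
     accessible K -> has_directed_colimits K ->
     accessible L -> has_directed_colimits L ->
   forall F G : Functor K L,
     preserves_directed_colimits F -> preserves_directed_colimits G ->
   forall phi psi : NatTrans F G,
     accessible (equifier phi psi) /\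
     has_directed_colimits (equifier phi psi) /\
     preserves_directed_colimits (eq_incl phi psi) /\
     (forall (B : Cat), accessible B -> has_directed_colimits B ->
      forall H : Functor B K, preserves_directed_colimits H ->
      forall e : whisker phi H = whisker psi H,
        preserves_directed_colimits (eq_lift e))).
Proof.
split; [|split].
- move=> I K accK hK; split; first exact: prod_accessible.
  split; first exact: prod_has_directed_colimits.
  split=> [i|L _ _ Q QP]; first exact/preservesE/prod_proj_preserves.
  (* Colimits in the product are detected by the projections, whose composites with the lift are the
     [Q i]. *)
  apply/preservesE => P X x l dP Xx; apply: colim_prod => i.
  by have /preservesE := QP i; apply.
- move=> K L accK hK accL _ F G /preservesE FP /preservesE GP.
  have [hI iP] := inserter_creation G FP hK.
  split; first exact: inserter_accessible.
  split=> //; split=> [|B _ _ H /preservesE HP psi]; first exact/preservesE.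
  (* The projection reflects directed colimits, and its composite with the lift is [H]. *)
  apply/preservesE => P X x l dP Xx; apply: colim_inserter => //.
  exact: HP.
- move=> K L accK hK accL _ F G /preservesE FP /preservesE GP phi psi.
  have [hE iP] := equifier_creation phi psi FP hK.
  split; first exact: equifier_accessible.
  split=> //; split=> [|B _ _ H /preservesE HP e]; first exact/preservesE.
  apply/preservesE => P X x l dP Xx; apply: colim_equifier.
  exact: HP.
Qed.
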